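(* Let $F$ be a tropical $k$-fan in $\mathbb R^n$ with strictly positive weights and let $T$ be a tropical regular function on $\mathbb R^n$. Then $\deg(T^k\cdot[F])=0$ if and only if $L(T)\cap\langle\sigma\rangle\neq0$ for every maximal cone $\sigma\in F^{(k)}$, where $\langle\sigma\rangle:=\operatorname{span}_{\mathbb R}(\sigma)$.
   Context: **Fans and cycles.** A tropical $k$-fan in $\mathbb R^n$ is a rational polyhedral fan $F$, pure of dimension $k$, with weights $\omega_F\colon F^{(k)}\to\mathbb Z_{\ge0}$ ($F^{(j)}$ = set of $j$-dimensional cones) that is balanced: for all $\tau\in F^{(k-1)}$, $\sum_{\sigma\in F^{(k)},\sigma>\tau}\omega_F(\sigma)v_{\sigma/\tau}\in\langle\tau\rangle$, where $v_{\sigma/\tau}\in\mathbb Z_\sigma:=\langle\sigma\rangle\cap\mathbb Z^n$ represents the primitive generator of $\mathbb Z_\sigma/\mathbb Z_\tau$ pointing into $\sigma$. A refinement of $F$ is a tropical fan each of whose cones lies in a cone of $F$, with the same support and induced weights; $[F]$ denotes the equivalence class of $F$, where two tropical fans are equivalent if, after discarding maximal cones of weight zero, they have a common refinement. **Functions.** A tropical regular function on $\mathbb R^n$ is $T=\max(l_1,\dots,l_q)$ with $l_i\in(\mathbb Z^n)^\vee$, always assumed written with one of the functionals equal to $0$. Its lineality space is $L(T)=\{x\in\mathbb R^n\mid l_i(x)=l_j(x)\ \forall i,j\}$. **Product and degree.** If $T$ is linear on each cone of a representative $F$ (refine if needed), $T\cdot[F]$ is the $(k-1)$-cycle represented by the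 cones of $F$ of dimension $\le k-1$, with the weight of $\tau\in F^{(k-1)}$ equal to $\sum_{\sigma>\tau}T_\sigma(\omega_F(\sigma)v_{\sigma/\tau})-T_\tau\big(\sum_{\sigma>\tau}\omega_F(\sigma)v_{\sigma/\tau}\big)$, where $T_\sigma,T_\tau$ are the linear functionals on $\langle\sigma\rangle,\langle\tau\rangle$ extending $T|_\sigma,T|_\tau$. $T^k\cdot[F]$ is the $k$-fold iterated product; it is the origin with an integer weight $\deg(T^k\cdot[F])$. *)

(* Defs.v *)
From HB Require Import structures.
From mathcomp Require Import all_boot all_order all_algebra.
From mathcomp Require Import boolp classical_sets functions cardinality fsbigop.
From mathcomp Require Import reals.

Set Implicit Arguments.
Unset Strict Implicit.
Unset Printing Implicit Defensive.

Import Order.TTheory GRing.Theory Num.Theory.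

Local Open Scope classical_set_scope.
Local Open Scope ring_scope.

Section Cones.
Variables (R : realType) (n : nat).
Implicit Types (A s t : set 'rV[R]_n) (l x v : 'rV[R]_n).

Definition ev l x : R := \sum_i l 0 i * x 0 i.

Definition intvec (z : 'rV[int]_n) : 'rV[R]_n := map_mx intr z.

Definition is_vspan A (U : {vspace 'rV[R]_n}) : Prop :=
  (forall x, A x -> x \in U) /\
  (forall V : {vspace 'rV[R]_n}, (forall x, A x -> x \in V) -> (U <= V)%VS).

(* The linear hull of an arbitrary set of vectors: the least subspace that
   contains it ([vspanP] shows that it exists). *)
Definition vspan A : {vspace 'rV[R]_n} := xget 0%VS (is_vspan A).

Lemma vspanP A : is_vspan A (vspan A).
Proof.
suff [U AU] : exists U, is_vspan A U by apply: (@xgetPex _ 0%VS (is_vspan A)); exists U.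
pose Q (U : {vspace 'rV[R]_n}) : Prop :=
  forall V : {vspace 'rV[R]_n}, (forall x, A x -> x \in V) -> (U <= V)%VS.
suff H m (U : {vspace 'rV[R]_n}) :
    Q U -> (\dim {: 'rV[R]_n} - \dim U <= m)%N -> exists U, is_vspan A U.
  by apply: (H _ 0%VS) (leqnn _) => V _; exact: sub0v.
elim: m U => [|m IHm] U QU le_m.
  exists U; split=> // x _.
  suff -> : U = fullv by exact: memvf.
  by apply/eqP; rewrite eqEdim subvf /= -subn_eq0 -leqn0.
have [AU|] := pselect (forall x, A x -> x \in U); first by exists U.
move=> /existsNP[x /not_implyP[Ax /negP xNU]].
apply: (IHm (U + <[x]>)%VS) => [V AV|].
  by rewrite subv_add QU // -memvE AV.
have ltU : (\dim U < \dim (U + <[x]>)%VS)%N.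
  rewrite ltn_neqAle dimvS ?addvSl // andbT.
  apply: contra xNU => /eqP eqU.
  have /eqP -> : U == (U + <[x]>)%VS by rewrite eqEdim addvSl eqU /=.
  by rewrite (subvP (addvSr U <[x]>%VS)) // memv_line.
have leU : (\dim (U + <[x]>)%VS <= \dim {: 'rV[R]_n})%N by rewrite dimvS ?subvf.
move: le_m; rewrite !leq_subLR => le_m.
by apply: leq_trans le_m _; rewrite addnS -addSn leq_add2r.
Qed.

Definition cdim A : nat := \dim (vspan A).

(* Finite intersection of closed half-spaces through the origin with integral
   normal vectors; cones with a nontrivial lineality space are allowed. *)
Definition rational_cone s : Prop :=
  exists (m : nat) (a : 'I_m -> 'rV[int]_n),
    s = [set x | forall i, 0 <= ev (intvec (a i)) x].

(* [t] is a face of [s] (possibly [s] itself, taking [l = 0]). *)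
Definition face t s : Prop :=
  exists l, (forall x, s x -> 0 <= ev l x) /\ t = [set x | s x /\ ev l x = 0].

(* Z_s = <s> /\ Z^n *)
Definition lattice_of s : set 'rV[R]_n :=
  [set x | x \in vspan s /\ exists z, x = intvec z].

(* [v] represents the generator of the rank one group Z_s / Z_t whose class
   lies in the image of [s] modulo <t>. *)
Definition is_primgen s t v : Prop :=
  [/\ lattice_of s v,
      exists u, u \in vspan t /\ s (v + u) &
      forall x, lattice_of s x -> exists a : int, lattice_of t (x - a%:~R *: v)].

(* v_{s/t}; the choice of the representative is immaterial in balancing and in
   the weights of a product. *)
Definition primgen s t : 'rV[R]_n := xget 0 (is_primgen s t).

End Cones.

Section Fans.
Variables (R : realType) (n : nat).

(* Cones are sets of points.  Only the values of [wt] on the cones of maximal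
   dimension are meaningful; weights live in [R] so that the weights of a
   product can be written down before being known to be integral. *)
Record wfan := WFan {
  cones : set (set 'rV[R]_n);
  wt : set 'rV[R]_n -> R }.

Implicit Types F G : wfan.

Definition cones_dim F (j : nat) : set (set 'rV[R]_n) :=
  [set s | cones F s /\ cdim s = j].

Definition support F : set 'rV[R]_n := \bigcup_(s in cones F) s.

Definition rational_fan F : Prop :=
  [/\ finite_set (cones F),
      forall s, cones F s -> rational_cone s,
      forall s t, cones F s -> face t s -> cones F t &
      forall s t, cones F s -> cones F t ->
        face (s `&` t) s /\ face (s `&` t) t].

Definition pure F (k : nat) : Prop :=
  (forall s, cones F s -> (cdim s <= k)%N) /\
  (forall s, cones F s -> exists2 r, cones_dim F k r & s `<=` r).

(* The cones of dimension [k] having [t] as a face. *)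
Definition star_max F (k : nat) (t : set 'rV[R]_n) : set (set 'rV[R]_n) :=
  [set s | cones_dim F k s /\ face t s].

Definition balanced F (k : nat) : Prop :=
  forall t, cones F t -> (cdim t).+1 = k ->
    \sum_(s \in star_max F k t) (wt F s *: primgen s t) \in vspan t.

Definition tropical_fan F (k : nat) : Prop :=
  [/\ rational_fan F, pure F k,
      forall s, cones_dim F k s -> wt F s \is a Num.nat &
      balanced F k].

Definition refines (k : nat) G F : Prop :=
  [/\ tropical_fan G k,
      forall s, cones G s -> exists2 r, cones F r & s `<=` r,
      support G = support F &
      forall s r, cones_dim G k s -> cones_dim F k r -> s `<=` r ->
        wt G s = wt F r].

(* Discard the maximal cones of weight zero. *)
Definition trim (k : nat) F : wfan :=
  WFan [set s | cones F s /\
          exists r, [/\ cones_dim F k r, wt F r != 0 & face s r]]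
       (wt F).

Definition fan_equiv (k : nat) F G : Prop :=
  exists H, refines k H (trim k F) /\ refines k H (trim k G).

End Fans.

(* max (l_0, ..., l_q) with one of the l_i equal to 0. *)
Record tropical_regular (n : nat) := TropicalRegular {
  tr_size : nat;
  tr_form : 'I_tr_size.+1 -> 'rV[int]_n;
  tr_zero : exists i, tr_form i = 0 }.
Arguments tr_form {n} t i.

Section Functions.
Variables (R : realType) (n : nat) (T : tropical_regular n).

Definition teval (x : 'rV[R]_n) : R :=
  \big[Num.max/ev (intvec R (tr_form T ord0)) x]_i
    ev (intvec R (tr_form T i)) x.

(* L(T) *)
Definition lineality : set 'rV[R]_n :=
  [set x | forall i j,
     ev (intvec R (tr_form T i)) x = ev (intvec R (tr_form T j)) x].

Definition linear_form_on (s : set 'rV[R]_n) (l : 'rV[R]_n) : Prop :=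
  forall x, s x -> teval x = ev l x.

Definition linear_on_cones (F : wfan R n) : Prop :=
  forall s, cones F s -> exists l, linear_form_on s l.

(* T_s, as a linear form on the whole space that agrees with T on s; only its
   restriction to <s> is meaningful, and that is uniquely determined. *)
Definition linext (s : set 'rV[R]_n) : 'rV[R]_n := xget 0 (linear_form_on s).

Definition prod_wt (k : nat) (F : wfan R n) (t : set 'rV[R]_n) : R :=
  \sum_(s \in star_max F k t) ev (linext s) (wt F s *: primgen s t)
  - ev (linext t) (\sum_(s \in star_max F k t) wt F s *: primgen s t).

(* The product of T with a (k+1)-dimensional fan on whose cones T is linear. *)
Definition tprod (k : nat) (F : wfan R n) : wfan R n :=
  WFan [set s | cones F s /\ (cdim s <= k)%N] (prod_wt k.+1 F).

(* T^k . F for a k-dimensional fan F on whose cones T is linear; T is then also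
   linear on the cones of all intermediate products. *)
Fixpoint tpow (k : nat) (F : wfan R n) : wfan R n :=
  if k is k'.+1 then tpow k' (tprod k' F) else F.

(* The weight of the origin in a 0-dimensional fan (0 for the empty cycle). *)
Definition origin_wt (F : wfan R n) : R :=
  if `[< cones F [set 0] >] then wt F [set 0] else 0.

(* deg (T^k . [F]) = d, computed on a representative of [F] on whose cones T is
   linear. *)
Definition deg_pow (k : nat) (F : wfan R n) (d : R) : Prop :=
  exists G, [/\ tropical_fan G k, fan_equiv k F G, linear_on_cones G &
                d = origin_wt (tpow k G)].

End Functions.
Arguments lineality R {n} T.

(* Main.v *)
(* The degree is computed by iterating the product T . G on a representative G of
   [F] on whose cones T is linear; the linear hulls of the maximal cones of nonzero
   weight do not depend on the representative.  Call a cone transverse if its linear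
   hull meets L(T) only in 0.  It suffices to show that some maximal cone of nonzero
   weight of a balanced fan G with nonnegative weights is transverse if and only if
   the same holds for T . G, which is again balanced with nonnegative weights.

   Let l_i realise T on a codimension one cone t.  By balancing, the weight of t in
   T . G is the sum over s > t of w(s) (T_s - l_i)(v_{s/t}), whose terms are
   nonnegative since T >= l_i.  If t is transverse and s is not, then v_{s/t} is a
   multiple of an element of L(T) modulo the span of t, so the term of s vanishes;
   hence t needs a transverse s to get a nonzero weight.  Conversely, assume that
   all transverse t have weight 0 and that T = l_i on some transverse s0 of positive
   weight.  The transverse maximal cones of positive weight on which T = l_i then
   form a subfan that is balanced modulo L(T), on which every l_j - l_i is
   nonpositive.  A balanced positive fan contained in a half-space lies in the
   bounding hyperplane, so all l_j agree on s0, which is absurd. *)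
From HB Require Import structures.
Require Import Defs.
From mathcomp Require Import all_boot all_order all_algebra.
From mathcomp Require Import boolp classical_sets functions cardinality fsbigop.
From mathcomp Require Import reals.
From mathcomp Require Import ring lra zify.

Set Implicit Arguments.
Unset Strict Implicit.
Unset Printing Implicit Defensive.

Import Order.TTheory GRing.Theory Num.Theory.

Local Open Scope classical_set_scope.
Local Open Scope ring_scope.

(** * Linear forms and linear hulls *)

Section LinearForms.
Variables (R : realType) (n : nat).
Implicit Types (A s t : set 'rV[R]_n) (l x v : 'rV[R]_n) (U V : {vspace 'rV[R]_n}).

Lemma evE l x : ev l x = (x *m l^T) 0 0.
Proof. by rewrite mxE; apply: eq_bigr => i _; rewrite mxE mulrC. Qed.

Lemma evDr l x y : ev l (x + y) = ev l x + ev l y.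
Proof. by rewrite !evE mulmxDl mxE. Qed.
Lemma evZr l a x : ev l (a *: x) = a * ev l x.
Proof. by rewrite !evE -scalemxAl mxE. Qed.
Lemma evDl l m x : ev (l + m) x = ev l x + ev m x.
Proof. by rewrite !evE linearD mulmxDr mxE. Qed.
Lemma evZl a l x : ev (a *: l) x = a * ev l x.
Proof. by rewrite !evE linearZ /= -scalemxAr mxE. Qed.
Lemma ev0l x : ev 0 x = 0.
Proof. by rewrite -(scale0r 0) evZl mul0r. Qed.
Lemma ev0r l : ev l 0 = 0.
Proof. by rewrite -(scale0r 0) evZr mul0r. Qed.
Lemma evNl l x : ev (- l) x = - ev l x.
Proof. by rewrite -scaleN1r evZl mulN1r. Qed.
Lemma evNr l x : ev l (- x) = - ev l x.
Proof. by rewrite -scaleN1r evZr mulN1r. Qed.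
Lemma evBl l m x : ev (l - m) x = ev l x - ev m x.
Proof. by rewrite evDl evNl. Qed.
Lemma evBr l x y : ev l (x - y) = ev l x - ev l y.
Proof. by rewrite evDr evNr. Qed.

Lemma ev_sumr (I : Type) (r : seq I) (P : pred I) l (f : I -> 'rV[R]_n) :
  ev l (\sum_(i <- r | P i) f i) = \sum_(i <- r | P i) ev l (f i).
Proof. exact: (big_morph _ (evDr l) (ev0r l)). Qed.

Definition hyper l : {vspace 'rV[R]_n} :=
  lker (linfun (fun x => x *m l^T : 'rV[R]_1)).

Lemma hyperP l x : reflect (ev l x = 0) (x \in hyper l).
Proof.
have lin : linear (fun x : 'rV[R]_n => x *m l^T).
  by move=> a y z; rewrite mulmxDl scalemxAl.
pose f : {linear _ -> _} := HB.pack (fun x : 'rV[R]_n => x *m l^T : 'rV[R]_1)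
   (GRing.isLinear.Build _ _ _ _ _ lin).
rewrite memv_ker (lfunE f) /= evE; apply: (iffP eqP) => [->|h].
  by rewrite mxE.
by apply/rowP => i; rewrite ord1 h mxE.
Qed.

Lemma dim_cap_hyper U l : (\dim U <= (\dim (U :&: hyper l)%VS).+1)%N.
Proof.
rewrite -(limg_ker_dim (linfun (fun x => x *m l^T : 'rV[R]_1)) U) -[X in (_ <= X)%N]addn1.
by apply: leq_add => //; apply: leq_trans (dimvS (subvf _)) _; rewrite dimvf.
Qed.

Lemma dim_cap_hyper_lt U l x : x \in U -> ev l x <> 0 ->
  \dim U = (\dim (U :&: hyper l)%VS).+1.
Proof.
move=> xU lx; apply/eqP; rewrite eqn_leq dim_cap_hyper /=.
rewrite ltn_neqAle dimvS ?capvSl// andbT; apply/negP => /eqP eqd.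
have /eqP eU : ((U :&: hyper l)%VS == U) by rewrite eqEdim capvSl eqd leqnn.
by move: xU; rewrite -eU memv_cap => /andP[_ /hyperP].
Qed.

(** Dimension count: [V] lies in the kernel of [l] on [U], which has codimension one in [U] because
    [l] is nonzero at [x]. *)
Lemma eq_hyper_cap U V l x : (V <= U)%VS -> {in V, forall v, ev l v = 0} ->
  x \in U -> ev l x <> 0 -> \dim U = (\dim V).+1 ->
  forall y, y \in U -> ev l y = 0 -> y \in V.
Proof.
move=> VU lV xU lx dU y yU ly.
have sub : (V <= U :&: hyper l)%VS.
  by rewrite subv_cap VU; apply/subvP => v /lV /hyperP.
have /eqP -> : V == (U :&: hyper l)%VS.
  rewrite eqEdim sub /=.
  by rewrite -ltnS -dU (dim_cap_hyper_lt xU lx).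
by rewrite memv_cap yU; apply/hyperP.
Qed.

(** The form is a coordinate of [z - projv U z], which kills [U]; the coordinate is chosen nonzero
    at [x] and rescaled there. *)
Lemma separating_form U x : x \notin U ->
  exists l, {in U, forall u, ev l u = 0} /\ ev l x = 1.
Proof.
move=> xU; pose p z := z - projv U z.
have px : p x != 0.
  by apply: contra xU; rewrite subr_eq0 => /eqP ->; rewrite memv_proj.
have [j pxj] : exists j, p x 0 j != 0.
  by apply/existsP; rewrite -negb_forall; apply: contra px => /forallP h;
     apply/eqP/rowP => j; rewrite (eqP (h j)) mxE.
pose l : 'rV[R]_n := \row_i (p (delta_mx 0 i) 0 j / p x 0 j).
have lE z : ev l z = p z 0 j / p x 0 j.
  rewrite [z in RHS]row_sum_delta /p linear_sum -sumrB /ev summxE mulr_suml.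
  by apply: eq_bigr => i _; rewrite !(linearZ, mxE) /=; ring.
exists l; split=> [u uU|]; last by rewrite lE divff.
by rewrite lE /p projv_id ?subrr ?mxE ?mul0r.
Qed.

Lemma mem_vspan A x : A x -> x \in vspan A.
Proof. by have [+ _] := vspanP A; apply. Qed.

Lemma vspan_sub A U : (forall x, A x -> x \in U) -> (vspan A <= U)%VS.
Proof. by have [_] := vspanP A; apply. Qed.

Lemma vspanS A s : A `<=` s -> (vspan A <= vspan s)%VS.
Proof. by move=> As; apply: vspan_sub => x /As /mem_vspan. Qed.

Lemma cdimS A s : A `<=` s -> (cdim A <= cdim s)%N.
Proof. by move=> As; rewrite dimvS ?vspanS. Qed.

Lemma ev_vspan0 A l : (forall x, A x -> ev l x = 0) ->
  {in vspan A, forall x, ev l x = 0}.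
Proof.
move=> h x xA; apply/hyperP; apply: subvP xA; apply: vspan_sub => y /h ?.
exact/hyperP.
Qed.

Lemma ev_vspan_eq A l m : (forall x, A x -> ev l x = ev m x) ->
  {in vspan A, forall x, ev l x = ev m x}.
Proof.
move=> h x xA; apply/subr0_eq; rewrite -evBl; apply: ev_vspan0 xA => y Ay.
by rewrite evBl h ?subrr.
Qed.

End LinearForms.

(** * Polyhedral cones and their faces *)

Section Cones.
Variables (R : realType) (n : nat).
Implicit Types (A s t : set 'rV[R]_n) (l x v : 'rV[R]_n) (U V : {vspace 'rV[R]_n}).

Definition convex_cone s : Prop :=
  [/\ s 0, forall x y, s x -> s y -> s (x + y) &
      forall c x, 0 <= c -> s x -> s (c *: x)].

Lemma rational_convex s : rational_cone s -> convex_cone s.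
Proof.
move=> [m [a ->]]; split=> [i|x y hx hy i|c x c0 hx i] /=.
- by rewrite ev0r.
- by rewrite evDr addr_ge0.
- by rewrite evZr mulr_ge0.
Qed.

Lemma face_convex s t : convex_cone s -> face t s -> convex_cone t.
Proof.
move=> [s0 sD sZ] [l [_ ->]]; split=> /= [|x y [sx lx] [sy ly]|c x c0 [sx lx]].
- by rewrite ev0r.
- by rewrite evDr lx ly addr0; split=> //; apply: sD.
- by rewrite evZr lx mulr0; split=> //; apply: sZ.
Qed.

Lemma face_sub s t : face t s -> t `<=` s.
Proof. by move=> [l [_ ->]] x []. Qed.

Lemma face_span s t : face t s -> (vspan t <= vspan s)%VS.
Proof. by move/face_sub/vspanS. Qed.

Lemma face_refl s : face s s.
Proof.
exists 0; split=> [x _|]; first by rewrite ev0l.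
by apply/seteqP; split=> x /=; rewrite ev0l => // -[].
Qed.

Lemma face_eq s t : face t s -> (cdim s <= cdim t)%N -> t = s.
Proof.
move=> fts; have ts := face_sub fts; move: fts => [l [l0 tE]] d.
have /eqP e : vspan t == vspan s by rewrite eqEdim vspanS.
rewrite tE; apply/seteqP; split=> [x []//|x sx]; split=> //.
have := mem_vspan sx; rewrite -e; apply: ev_vspan0 => y.
by rewrite tE => -[].
Qed.

(** Add up witnesses, one for each form that is not identically zero on [s]; nonnegativity prevents
    cancellation. *)
Lemma common_positive (r : seq 'rV[R]_n) s : convex_cone s ->
  (forall a x, a \in r -> s x -> 0 <= ev a x) ->
  exists2 y, s y & forall a, a \in r -> (exists2 x, s x & ev a x != 0) -> 0 < ev a y.
Proof.
move=> [s0 sD sZ]; elim: r => [|a r IH] ar; first by exists 0.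
have [b x br|y sy yr] := IH; first by apply: ar; rewrite inE br orbT.
have [[x sx ax]|no] := pselect (exists2 x, s x & ev a x != 0).
  exists (y + x) => [|b]; first exact: sD.
  rewrite inE evDr => /orP[/eqP -> _|br h].
    rewrite ltr_wpDl ?ar ?inE ?eqxx//.
    by rewrite lt_neqAle eq_sym ax ar // inE eqxx.
  by rewrite ltr_pwDl ?yr// ar// inE br orbT.
exists y => // b; rewrite inE => /orP[/eqP -> //|]; exact: yr.
Qed.

Lemma small_step (r : seq 'rV[R]_n) x y :
  (forall a, a \in r -> 0 < ev a y \/ (ev a y = 0 /\ ev a x = 0)) ->
  exists2 e : R, 0 < e & forall a, a \in r -> 0 <= ev a (y + e *: x).
Proof.
elim: r => [|a r IH] h; first by exists 1.
have [b br|e e0 er] := IH; first by apply: h; rewrite inE br orbT.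
have [e' e'0 e'a] : exists2 e' : R, 0 < e' &
    forall d, 0 < d -> d <= e' -> 0 <= ev a (y + d *: x).
  have [|ay|[ay ax]] := h a; first by rewrite inE eqxx.
    (* The [+ 1] keeps the denominator positive; for [d] up to this bound the change [d * ev a x]
       cannot outweigh [ev a y]. *)
    exists (ev a y / (`|ev a x| + 1)); first by rewrite divr_gt0// ltr_wpDl.
    move=> d d0; rewrite ler_pdivlMr ?ltr_wpDl// => le.
    rewrite evDr evZr.
    have := ler_norm (- ev a x); rewrite normrN; nra.
  by exists 1 => // d _ _; rewrite evDr evZr ay ax mulr0 addr0.
exists (Num.min e e') => [|b]; first by rewrite lt_min e0.
rewrite inE => /orP[/eqP ->|br].
  by apply: e'a; rewrite ?lt_min ?e0 // ge_min lexx orbT.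
have := er b br; rewrite !evDr !evZr => be.
have m0 : 0 < Num.min e e' by rewrite lt_min e0.
have me : Num.min e e' <= e by rewrite ge_min lexx.
have by0 : 0 <= ev b y.
  by have [|/ltW//|[-> _]//] := h b; rewrite inE br orbT.
have [bx|bx] := lerP 0 (ev b x); last by nra.
by rewrite addr_ge0 // mulr_ge0 // ltW.
Qed.

Lemma rational_step m (a : 'I_m -> 'rV[int]_n) s x y :
  s = [set x | forall i, 0 <= ev (intvec R (a i)) x] ->
  s y -> (forall i, ev (intvec R (a i)) y = 0 -> ev (intvec R (a i)) x = 0) ->
  exists2 e : R, 0 < e & s (y + e *: x).
Proof.
move=> sE sy h.
have [_ /codomP[i ->]|e e0 er] :=
   @small_step (codom (fun i => intvec R (a i))) x y.
  move: (sy); rewrite sE => /(_ i); rewrite le_eqVlt => /orP[/eqP/esym e|?].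
    by right; split=> //; apply: h.
  by left.
by exists e => //; rewrite sE => i; apply: er; apply: codom_f.
Qed.

(** The point [y] makes strict every inequality that is not an equality on all of [s], so a
    direction killed by the implicit equalities can be followed a little: [y] is a relative interior
    point. *)
Lemma relint m (a : 'I_m -> 'rV[int]_n) s :
  s = [set x | forall i, 0 <= ev (intvec R (a i)) x] ->
  exists2 y, s y & forall x,
    (forall i, (forall z, s z -> ev (intvec R (a i)) z = 0) ->
       ev (intvec R (a i)) x = 0) ->
    exists2 e : R, 0 < e & s (y + e *: x).
Proof.
move=> sE.
have rs : rational_cone s by exists m, a.
have [_ x /codomP[i ->]|y sy yr] :=
    @common_positive (codom (fun i => intvec R (a i))) s (rational_convex rs).
  by rewrite sE; apply.
exists y => // x h; apply: rational_step sE sy _ => i ay.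
apply: h => z sz; apply/eqP/negPn/negP => az.
have := yr (intvec R (a i)); rewrite ay ltxx => /(_ (codom_f _ _)) H.
by have := H (ex_intro2 _ _ z sz az).
Qed.

(** The linear hull is cut out by the implicit equalities, which are integral; this is the source of
    lattice points in it. *)
Lemma vspan_rational m (a : 'I_m -> 'rV[int]_n) s x :
  s = [set x | forall i, 0 <= ev (intvec R (a i)) x] ->
  (forall i, (forall z, s z -> ev (intvec R (a i)) z = 0) ->
       ev (intvec R (a i)) x = 0) -> x \in vspan s.
Proof.
move=> sE h; have [y sy /(_ x h)[e e0 se]] := relint sE.
have -> : x = e^-1 *: (y + e *: x - y).
  by rewrite addrC addKr scalerA mulVf ?scale1r ?gt_eqF.
by rewrite memvZ // memvB ?mem_vspan.
Qed.

Lemma rational_relint s : rational_cone s ->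
  exists2 y, s y & forall x, x \in vspan s -> exists2 e : R, 0 < e & s (y + e *: x).
Proof.
move=> [m [a sE]]; have [y sy h] := relint sE; exists y => // x xs.
by apply: h => i si; apply: ev_vspan0 xs.
Qed.

(** Otherwise every inequality that vanishes on [t] vanishes on [s]. From a point of [t] where the
    others are strict one can step along [- x] inside [s], for any [x] in [s]; the form defining [t]
    must then vanish at [x], so [t = s]. *)
Lemma facet_inequality m (a : 'I_m -> 'rV[int]_n) s t :
  s = [set x | forall i, 0 <= ev (intvec R (a i)) x] ->
  face t s -> t <> s ->
  exists i, (forall z, t z -> ev (intvec R (a i)) z = 0) /\
    exists2 x, s x & 0 < ev (intvec R (a i)) x.
Proof.
move=> sE fts tNs; apply: contrapT => no; apply: tNs.
have rs : rational_cone s by exists m, a.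
have cs := rational_convex rs.
have ct := face_convex cs fts.
have [_ x /codomP[i ->] /(face_sub fts)|y ty yr] :=
    @common_positive (codom (fun i => intvec R (a i))) t ct.
  by rewrite sE; apply.
have sy := face_sub fts ty.
case: (fts) => l [l0 tE]; rewrite tE; apply/seteqP; split=> [x []//|x sx]; split=> //.
have [i|e e0] := @rational_step m a s (- x) y sE sy.
  move=> ay; rewrite evNr; apply/eqP; rewrite oppr_eq0; apply/negPn/negP => ax.
  apply: no; exists i; split; last first.
    by exists x => //; rewrite lt_neqAle eq_sym ax; move: sx; rewrite sE; apply.
  move=> z tz; apply/eqP/negPn/negP => az.
  have := yr (intvec R (a i)); rewrite ay ltxx => /(_ (codom_f _ _)) H.
  by have := H (ex_intro2 _ _ z tz az).
move=> /l0; rewrite evDr evZr evNr.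
have -> : ev l y = 0 by move: ty; rewrite tE => -[].
have := l0 _ sx; nra.
Qed.

(* Finite generation, stated dually so that the conic combinations need not be
   written down. *)
Definition generates (X : seq 'rV[R]_n) s : Prop :=
  (forall x, x \in X -> s x) /\
  (forall f, (forall x, x \in X -> 0 <= ev f x) -> forall x, s x -> 0 <= ev f x).

Lemma separate_bounds (I : eqType) (r : seq I) (P Q : pred I) (u : I -> R) :
  (forall i j, i \in r -> j \in r -> P i -> Q j -> u i <= u j) ->
  (forall j, j \in r -> Q j -> 0 <= u j) ->
  exists2 c : R, 0 <= c & forall i, i \in r -> (P i -> u i <= c) /\ (Q i -> c <= u i).
Proof.
move=> h1 h2; exists (\big[Num.max/0]_(i <- r | P i) u i).
  exact: bigmax_ge_id.
move=> i ir; split=> [Pi|Qi]; first exact: le_bigmax_seq.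
rewrite big_seq_cond bigmax_le ?h2// => j /andP[jr Pj]; exact: h1.
Qed.

(* One step of Fourier-Motzkin elimination, in dual form: [f] is nonnegative on
   the cut cone because [f - c a] is nonnegative on [s] for a suitable [c >= 0]. *)
Lemma generates_cut X s a : convex_cone s -> generates X s ->
  exists Y, generates Y [set x | s x /\ 0 <= ev a x].
Proof.
move=> cs [Xs gX].
(* The generators on the nonnegative side, together with the positive combination on the hyperplane
   [a = 0] of each pair lying strictly on opposite sides. *)
pose Y := [seq x <- X | 0 <= ev a x] ++
  [seq ev a p.1 *: p.2 - ev a p.2 *: p.1 |
     p <- [seq p <- [seq (x, y) | x <- X, y <- X] | (0 < ev a p.1) && (ev a p.2 < 0)]].
case: (cs) => _ sD sZ.
exists Y; split=> [x|f fY x [sx ax]].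
  rewrite mem_cat mem_filter => /orP[/andP[ax /Xs sx]//|].
  move=> /mapP[[y z]]; rewrite mem_filter => /andP[/= /andP[ay az]].
  move=> /allpairsP[[y' z'] /= [yX zX [? ?]]] ->; subst y' z'; split.
    rewrite -scaleNr; apply: sD; apply: sZ; rewrite ?oppr_ge0 ?ltW//; exact: Xs.
  by rewrite evBr !evZr mulrC subrr.
have [|x0 x0X|c c0 cr] := @separate_bounds _ X (fun y => ev a y < 0)
    (fun x => 0 < ev a x) (fun x => ev f x / ev a x).
- move=> y z yX zX ay az.
  rewrite ler_pdivlMr // mulrAC ler_ndivrMr //.
  suff : 0 <= ev f (ev a z *: y - ev a y *: z).
    by rewrite evBr !evZr subr_ge0 mulrC [X in _ <= X]mulrC.
  apply: fY; rewrite mem_cat; apply/orP; right.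
  apply/mapP; exists (z, y) => //; rewrite mem_filter /= az ay /=.
  by apply/allpairsP; exists (z, y).
- move=> a0; rewrite divr_ge0 ?(ltW a0)// fY// mem_cat mem_filter (ltW a0).
  by rewrite x0X.
have : 0 <= ev (f - c *: a) x.
  apply: gX sx => y yX; rewrite evBl evZl subr_ge0.
  have [cl cu] := cr _ yX; case: (ltgtP 0 (ev a y)) => [a0|a0|a0].
  - by have := cu a0; rewrite ler_pdivlMr.
  - by have := cl a0; rewrite ler_ndivrMr.
  - by rewrite -a0 mulr0 fY// mem_cat mem_filter -a0 lexx yX.
by rewrite evBl evZl subr_ge0; apply: le_trans; rewrite mulr_ge0.
Qed.

(** Impose the inequalities one at a time, starting from the whole space, which is generated by the
    basis vectors and their opposites. *)
Lemma rational_generates s : rational_cone s -> exists X, generates X s.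
Proof.
move=> [m [a ->]].
suff H (r : seq 'rV[R]_n) :
    exists X, generates X [set x | forall b, b \in r -> 0 <= ev b x].
  have [X [Xs gX]] := H (codom (fun i => intvec R (a i))).
  exists X; split=> [x /Xs /= h i|f /gX h x hx]; first exact/h/codom_f.
  by apply: h => _ /= /codomP[i ->].
elim: r => [|b r [X gX]].
  exists ([seq delta_mx 0 i | i <- enum 'I_n] ++ [seq - delta_mx 0 i | i <- enum 'I_n]).
  split=> // f h x _; rewrite [x]row_sum_delta ev_sumr.
  rewrite big1 // => i _; rewrite evZr.
  suff -> : ev f (delta_mx 0 i) = 0 by rewrite mulr0.
  have pos : 0 <= ev f (delta_mx 0 i).
    by apply: h; rewrite mem_cat; apply/orP; left; apply/mapP; exists i; rewrite ?mem_enum.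
  have neg : 0 <= ev f (- delta_mx 0 i).
    by apply: h; rewrite mem_cat; apply/orP; right; apply/mapP; exists i; rewrite ?mem_enum.
  by apply/eqP; rewrite eq_le pos andbT -oppr_ge0 -evNr.
have cc : convex_cone [set x | forall b, b \in r -> 0 <= ev b x].
  split=> [c|x y hx hy c cr|d x d0 hx c cr] /=.
  - by rewrite ev0r.
  - by rewrite evDr addr_ge0 ?hx ?hy.
  - by rewrite evZr mulr_ge0 ?hx.
have [Y [Ys gY]] := generates_cut b cc gX.
exists Y; split=> [x /Ys[/= xr bx] c|f /gY h x hx].
  by rewrite inE => /orP[/eqP ->//|/xr].
apply: h; split=> [c cr|]; apply: hx; rewrite inE ?eqxx// cr orbT.
by [].
Qed.

End Cones.
(** * Primitive generators *)

Section Lattice.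
Variables (R : realType) (n : nat).
Implicit Types (s t : set 'rV[R]_n) (l x v : 'rV[R]_n).

Definition evz (a z : 'rV[int]_n) : int := \sum_i a 0 i * z 0 i.

Lemma ev_intvec (a z : 'rV[int]_n) : ev (intvec R a) (intvec R z) = (evz a z)%:~R.
Proof.
by rewrite rmorph_sum; apply: eq_bigr => i _; rewrite !mxE rmorphM.
Qed.

Lemma intvecZ (c : int) (z : 'rV[int]_n) : intvec R (c *: z) = c%:~R *: intvec R z.
Proof. exact: map_mxZ. Qed.

Lemma intvecN (z : 'rV[int]_n) : intvec R (- z) = - intvec R z.
Proof. exact: map_mxN. Qed.

Lemma intvecB (y z : 'rV[int]_n) : intvec R (y - z) = intvec R y - intvec R z.
Proof. exact: map_mxB. Qed.

Lemma clear_denominators (u : 'rV[rat]_n) :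
  exists2 N : int, N != 0 & exists z, map_mx intr z = N%:~R *: u.
Proof.
exists (\prod_j denq (u 0 j)); first by apply/prodf_neq0 => j _; rewrite denq_neq0.
exists (\row_j (numq (u 0 j) * \prod_(i | i != j) denq (u 0 i))).
apply/rowP => j; rewrite !mxE [in RHS](bigD1 j) //= !rmorphM /= numqE; ring.
Qed.

(** The real solutions of a rational system are combinations of rational ones, so [f] is nonzero on
    some row of the rational kernel; clearing denominators makes it integral. *)
Lemma integral_solution m (a : 'I_m -> 'rV[int]_n) (I : pred 'I_m) f x :
  (forall i, I i -> ev (intvec R (a i)) x = 0) -> ev f x <> 0 ->
  exists z, (forall i, I i -> evz (a i) z = 0) /\ ev f (intvec R z) <> 0.
Proof.
move=> ax fx.
pose A : 'M[rat]_(n, m) := \matrix_(j, i) (if I i then (a i 0 j)%:~R else 0).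
pose AR := map_mx (ratr : rat -> R) A.
have xk : (x <= kermx AR)%MS.
  apply/sub_kermxP/rowP => i; rewrite !mxE.
  have [Ii|/negPf Ii] := boolP (I i); last first.
    by rewrite big1 // => j _; rewrite !mxE Ii rmorph0 mulr0.
  rewrite -[RHS](ax i Ii); apply: eq_bigr => j _.
  by rewrite !mxE Ii ratr_int mulrC.
have [D xE] := submxP xk.
have [j fj] : exists j, ev f (row j (kermx AR)) <> 0.
  apply: contrapT => no; apply: fx; rewrite xE mulmx_sum_row ev_sumr big1 // => j _.
  rewrite evZr; suff -> : ev f (row j (kermx AR)) = 0 by rewrite mulr0.
  by apply: contrapT => h; apply: no; exists j.
have [N N0 [z zE]] := clear_denominators (row j (kermx A)).
have zR : intvec R z = N%:~R *: row j (kermx AR).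
  rewrite /AR -map_kermx -map_row.
  transitivity (map_mx (ratr : rat -> R) (map_mx intr z)).
    by apply/rowP => i; rewrite !mxE ratr_int.
  rewrite zE; apply/rowP => i; rewrite [LHS]mxE [in LHS]mxE rmorphM /= ratr_int.
  by rewrite [in LHS]mxE [RHS]mxE; congr (_ * _); rewrite !mxE.
exists z; split; last first.
  by rewrite zR evZr => /eqP; rewrite mulf_eq0 intr_eq0 (negPf N0) /= => /eqP.
move=> i Ii; apply/eqP; rewrite -(intr_eq0 R) -ev_intvec zR evZr.
have : row j (kermx AR) *m AR = 0 by rewrite -row_mul mulmx_ker row0.
move=> /rowP /(_ i); rewrite [RHS]mxE mxE => H.
suff -> : ev (intvec R (a i)) (row j (kermx AR)) = 0 by rewrite mulr0.
rewrite -[RHS]H; apply: eq_bigr => k _.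
by rewrite ![AR _ _]mxE !mxE Ii ratr_int mulrC.
Qed.

Lemma lattice_spans s f : rational_cone s -> (exists2 x, s x & ev f x <> 0) ->
  exists2 v, lattice_of s v & ev f v <> 0.
Proof.
move=> [m [a sE]] [x sx fx].
have [i Ii|z [az fz]] := @integral_solution m a
    (fun i => `[< forall z, s z -> ev (intvec R (a i)) z = 0 >]) f x _ fx.
  by move/asboolP: Ii; apply.
exists (intvec R z) => //; split; last by exists z.
apply: vspan_rational sE _ => i ai; rewrite ev_intvec az //; exact/asboolP.
Qed.

Section Primgen.
Variables (s t : set 'rV[R]_n).
Hypotheses (rs : rational_cone s) (fts : face t s) (dst : cdim s = (cdim t).+1).

(** A facet inequality [f] vanishes on [t], and its kernel in the hull of [s] is the hull of [t]. A
    lattice vector with the least positive value of [f] generates the quotient by Euclidean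
    division. *)
Lemma primgen_ex : exists v, is_primgen s t v.
Proof.
have [m [a sE]] := rs.
have tNs : t <> s by move=> e; move: dst; rewrite e => /n_Sn.
have [i [ait [x sx ax]]] := facet_inequality sE fts tNs.
pose f := ev (intvec R (a i)); pose g0 := evz (a i).
pose P (g : nat) := `[< (0 < g)%N /\ exists z, intvec R z \in vspan s /\ g0 z = g >].
have exP : exists g, P g.
  have [|v0 [v0s [z0 v0E]] av0] := @lattice_spans s (intvec R (a i)) rs.
    by exists x => //; apply/eqP; rewrite gt_eqF.
  exists `|g0 z0|%N; apply/asboolP; split.
    by rewrite absz_gt0; apply/eqP => e; apply: av0; rewrite v0E ev_intvec -/(g0 _) e.
  have [e|e] := ger0P (g0 z0).
    by exists z0; rewrite -v0E v0s gez0_abs.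
  exists (- z0); rewrite intvecN -v0E memvN v0s; split=> //.
  rewrite ltz0_abs // /g0 /evz -sumrN.
  by apply: eq_bigr => j _; rewrite mxE mulrN.
have [g /asboolP[g_gt0 [z [zs zg]]] gmin] := ex_minnP exP.
have inter : forall y, y \in vspan s -> f y = 0 -> y \in vspan t.
  apply: (@eq_hyper_cap _ _ _ _ (intvec R (a i)) x) => //.
  - exact: face_span.
  - exact: ev_vspan0.
  - exact: mem_vspan.
  - by apply/eqP; rewrite gt_eqF.
have fz : f (intvec R z) = g%:R by rewrite /f ev_intvec -/(g0 z) zg.
exists (intvec R z); split.
- by split=> //; exists z.
- have cs := rational_convex rs; case: cs => _ _ sZ.
  (* The rescaled [x] is the point of its ray where [f] takes the same value as at the chosen
     lattice vector. *)
  exists ((g%:R / f x) *: x - intvec R z); split; last first.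
    rewrite addrC subrK; apply: sZ => //.
    by rewrite divr_ge0 ?ler0n ?ltW.
  apply: inter; first by rewrite memvB // memvZ // mem_vspan.
  by rewrite /f evBr evZr divfK ?gt_eqF // -/(f _) fz subrr.
- move=> w [ys [y wE]]; move: ys; rewrite wE => ys.
  pose q := (g0 y %/ g)%Z; exists q.
  have yE : intvec R y - q%:~R *: intvec R z = intvec R (y - q *: z).
    by rewrite intvecB intvecZ.
  have evzB : g0 (y - q *: z) = (g0 y %% g)%Z.
    rewrite /modz -/q -zg /g0 /evz mulr_sumr -sumrB.
    by apply: eq_bigr => j _; rewrite !mxE; ring.
  have ins : intvec R y - q%:~R *: intvec R z \in vspan s by rewrite memvB ?memvZ.
  split; last by exists (y - q *: z).
  apply: inter => //.
  rewrite yE /f ev_intvec -/(g0 _) evzB.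
  have r0 : (0 <= g0 y %% g)%Z by rewrite modz_ge0 // eqz_nat -lt0n.
  have rg : (g0 y %% g < g)%Z by rewrite ltz_pmod.
  case: (eqVneq (g0 y %% g)%Z 0) => [->//|rN0]; exfalso.
  have /gmin : P `|(g0 y %% g)%Z|%N.
    apply/asboolP; split; first by rewrite absz_gt0.
    by exists (y - q *: z); rewrite -yE ins gez0_abs.
  by rewrite -lez_nat gez0_abs // leNgt rg.
Qed.

Lemma primgenP : is_primgen s t (primgen s t).
Proof. by have [v hv] := primgen_ex; apply: (@xgetPex _ 0 (is_primgen s t)); exists v. Qed.

Lemma primgen_span : primgen s t \in vspan s.
Proof. by have [[]] := primgenP. Qed.

Lemma primgen_face : exists2 u, u \in vspan t & s (primgen s t + u).
Proof. by have [_ [u [ut su]] _] := primgenP; exists u. Qed.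

(** If the generator were in the hull of [t], so would be all lattice points of [s]; but a facet
    inequality vanishing on [t] is nonzero at one of them. *)
Lemma primgen_notin : primgen s t \notin vspan t.
Proof.
apply/negP => vt; have [_ _ gen] := primgenP.
have tNs : t <> s by move=> e; move: dst; rewrite e => /n_Sn.
have [m [a sE]] := rs.
have [i [ait [x sx ax]]] := facet_inequality sE fts tNs.
have [|y ys] := @lattice_spans s (intvec R (a i)) rs.
  by exists x => //; apply/eqP; rewrite gt_eqF.
apply; have [c [yt _]] := gen _ ys; apply: ev_vspan0 ait _ _.
by rewrite -(subrK (c%:~R *: primgen s t) y) memvD ?memvZ.
Qed.

Lemma primgen_decomp x : x \in vspan s ->
  exists c : R, x - c *: primgen s t \in vspan t.
Proof.
move=> xs; have /separating_form[l [lt lv]] := primgen_notin.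
exists (ev l x).
have h : forall y, y \in vspan s -> ev l y = 0 -> y \in vspan t.
  apply: (@eq_hyper_cap _ _ _ _ _ (primgen s t)) => //; last by rewrite lv; exact/eqP/oner_neq0.
    exact: face_span.
  exact: primgen_span.
apply: h; first by rewrite memvB ?memvZ ?primgen_span.
by rewrite evBr evZr lv mulr1 subrr.
Qed.

End Primgen.
End Lattice.
(** * Facets between faces of codimension two *)

Section Diamond.
Variables (R : realType) (n : nat).
Implicit Types (s t th : set 'rV[R]_n) (l x v : 'rV[R]_n).

Lemma seq_argmax (I : eqType) (r : seq I) (P : pred I) (u : I -> R) :
  has P r -> exists i, [/\ i \in r, P i & forall j, j \in r -> P j -> u j <= u i].
Proof.
elim: r => //= a r IH; have [/IH [i [ir Pi ui]] _|/hasPn nP] := boolP (has P r).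
  have [/andP[Pa ua]|h] := boolP (P a && (u i <= u a)).
    exists a; split=> [||j]; rewrite ?inE ?eqxx// => /orP[/eqP ->//|jr Pj].
    exact: le_trans (ui _ jr Pj) ua.
  exists i; split=> [||j]; rewrite ?inE ?ir ?orbT// => /orP[/eqP -> Pa|]; last exact: ui.
  by move: h; rewrite Pa /= -ltNge => /ltW.
rewrite orbF => Pa; exists a; split=> [||j]; rewrite ?inE ?eqxx // => /orP[/eqP -> //|jr Pj].
by have := nP _ jr; rewrite Pj.
Qed.

Lemma face_over s t th : th `<=` t -> face t s -> face th s -> face th t.
Proof.
move=> tht /face_sub ts [l [l0 E]]; exists l; split=> [x /ts /l0//|].
apply/seteqP; split=> x.
  by move=> thx; split; [exact: tht|move: thx; rewrite E => -[]].
by move=> [/ts sx lx]; rewrite E.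
Qed.

Definition cut s l : set 'rV[R]_n := [set x | s x /\ ev l x = 0].

Lemma cut_face s l : (forall x, s x -> 0 <= ev l x) -> face (cut s l) s.
Proof. by exists l. Qed.

Lemma proper_face_positive s th l : rational_cone s -> th <> s -> th = cut s l ->
  (forall x, s x -> 0 <= ev l x) -> forall X, generates X s ->
  has (fun x => 0 < ev l x) X.
Proof.
move=> rs thNs thE l0 X [Xs gX]; apply: contrapT => /negP /hasPn h; apply: thNs.
rewrite thE; apply/seteqP; split=> [x []//|x sx]; split=> //.
apply/eqP; rewrite eq_le l0 // andbT -oppr_ge0 -evNl.
by apply: gX sx => y /h; rewrite -leNgt evNl oppr_ge0.
Qed.

(** Rotate the supporting form [l] about [th] until it touches a generator of [s] off [th]: [c] is
    the largest ratio of [q] to [l] on the generators where [l] is positive. The new face is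
    strictly larger than [th], and [y] keeps it from having full dimension. *)
Lemma upper_facet s th l q y :
  rational_cone s -> cdim s = (cdim th).+2 ->
  (forall x, s x -> 0 <= ev l x) -> th = cut s l ->
  (forall x, th x -> ev q x = 0) ->
  y \in vspan s -> ev l y = 0 -> ev q y <> 0 ->
  exists c, let f := c *: l - q in
    [/\ forall x, s x -> 0 <= ev f x, cdim (cut s f) = (cdim th).+1,
        th `<=` cut s f & exists2 z, cut s f z & 0 < ev l z].
Proof.
move=> rs ds l0 thE qth ys ly qy.
have thNs : th <> s by move=> e; move: ds; rewrite e; lia.
have [X gX] := rational_generates rs; have [Xs gX2] := gX.
have [z [zX lz zmax]] := seq_argmax (fun x => ev q x / ev l x)
  (proper_face_positive rs thNs thE l0 gX).
pose c := ev q z / ev l z.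
exists c => f.
have f0 x : s x -> 0 <= ev f x.
  apply: gX2 => {}x xX; rewrite evBl evZl subr_ge0.
  have [lx|lx] := ltP 0 (ev l x); first by rewrite -ler_pdivrMr // zmax.
  have lx0 : ev l x = 0 by apply/eqP; rewrite eq_le lx l0 //; exact: Xs.
  by rewrite lx0 mulr0 qth // thE; split=> //; exact: Xs.
have fz : ev f z = 0 by rewrite evBl evZl divfK ?subrr ?gt_eqF.
have sub : th `<=` cut s f.
  move=> x thx; have := thx; rewrite {1}thE => -[sx lx]; split=> //.
  by rewrite evBl evZl lx mulr0 qth ?subrr.
have zc : cut s f z by split=> //; exact: Xs.
split=> //; last by exists z.
have d1 : (cdim (cut s f) <= (cdim th).+1)%N.
  rewrite -ltnS -ds [cdim s](@dim_cap_hyper_lt _ _ (vspan s) f y) //.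
    rewrite ltnS dimvS // subv_cap vspanS; last by move=> ? [].
    by apply: vspan_sub => x [_ fx]; apply/hyperP.
  by rewrite evBl evZl ly mulr0 add0r; apply/eqP; rewrite oppr_eq0; exact/eqP.
apply/eqP; rewrite eqn_leq d1 ltn_neqAle cdimS // andbT; apply/negP => /eqP e.
have fth : face th (cut s f).
  by apply: face_over sub (cut_face f0) _; rewrite thE; exact: cut_face.
have /(face_eq fth) E : (cdim (cut s f) <= cdim th)%N by rewrite e.
by move: zc; rewrite -E thE => -[_ lz0]; move: lz; rewrite lz0 ltxx.
Qed.

Definition between (th s t : set 'rV[R]_n) : Prop :=
  [/\ cdim t = (cdim th).+1, face th t & face t s].

(** Rotating by [q] and by [- q] gives the two facets. Modulo the hull of [th], the hull of [s] is a
    plane, on which a form defining another facet is a nonnegative combination of [f1] and [f2];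
    vanishing off [th] forces one coefficient to be zero. *)
Lemma two_facets s th : rational_cone s -> face th s -> cdim s = (cdim th).+2 ->
  exists l f1 f2 c,
    [/\ [/\ forall x, s x -> 0 <= ev l x, forall x, s x -> 0 <= ev f1 x &
           forall x, s x -> 0 <= ev f2 x],
        th = cut s l /\ f1 + f2 = c *: l,
        between th s (cut s f1), between th s (cut s f2) &
        cut s f1 <> cut s f2 /\
        forall t, between th s t -> t = cut s f1 \/ t = cut s f2].
Proof.
move=> rs fth ds; have [l [l0 thE]] := fth.
have thNs : th <> s by move=> e; move: ds; rewrite e; lia.
have [y [ys ly yth]] : exists y, [/\ y \in vspan s, ev l y = 0 & y \notin vspan th].
  apply: contrapT => no.
  have : (vspan s :&: hyper l <= vspan th)%VS.
    apply/subvP => y; rewrite memv_cap => /andP[ys /hyperP ly].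
    by apply: contrapT => /negP yth; apply: no; exists y.
  move=> /dimvS; rewrite leqNgt => /negP; apply.
  by have := dim_cap_hyper (vspan s) l; rewrite -/(cdim s) -/(cdim th) ds.
have [q [qth qy]] := separating_form yth.
have qth' x : th x -> ev q x = 0 by move=> /mem_vspan /qth.
have qy0 : ev q y <> 0 by rewrite qy; exact/eqP/oner_neq0.
have [c1 /=] := upper_facet rs ds l0 thE qth' ys ly qy0.
set f1 := _ - q => -[f1s d1 th1 [z1 z1t lz1]].
have [||c2 /=] := @upper_facet s th l (- q) y rs ds l0 thE _ ys ly.
- by move=> x /qth'; rewrite evNl => ->; rewrite oppr0.
- by rewrite evNl qy; apply/eqP; rewrite oppr_eq0 oner_neq0.
set f2 := _ - - q => -[f2s d2 th2 [z2 z2t lz2]].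
have cE : f1 + f2 = (c1 + c2) *: l by rewrite /f1 /f2 opprK scalerDl addrACA addNr addr0.
have f12 x : ev f1 x + ev f2 x = (c1 + c2) * ev l x by rewrite -evDl cE evZl.
have f1y : ev f1 y = -1 by rewrite evBl evZl ly qy mulr0 sub0r.
(* Were the sum zero, the nonnegative forms [f1] and [f2] would be opposite and vanish on [s], while
   [f1] is [-1] at [y]. *)
have c0 : 0 < c1 + c2.
  rewrite lt_neqAle; apply/andP; split; last first.
    rewrite -(pmulr_lge0 _ lz1) -f12; case: z1t => sz _.
    by rewrite addr_ge0 ?f1s ?f2s.
  apply/negP => /eqP e.
  have f1s0 x : s x -> ev f1 x = 0.
    move=> sx; have := f12 x; rewrite -e mul0r.
    have := f1s _ sx; have := f2s _ sx; lra.
  have := ev_vspan0 f1s0 ys; rewrite f1y; lra.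
exists l, f1, f2, (c1 + c2); split=> //.
- split=> //; last exact: cut_face.
  by apply: face_over th1 (cut_face f1s) fth.
- split=> //; last exact: cut_face.
  by apply: face_over th2 (cut_face f2s) fth.
split.
  move=> e; have [_ h2] : cut s f2 z1 by rewrite -e.
  case: z1t => _ h1; have := f12 z1; rewrite h1 h2; have := mulr_gt0 c0 lz1; lra.
move=> t [dt ftht fts].
have [g [g0 tE]] := fts.
have gth x : x \in vspan th -> ev g x = 0.
  by apply: ev_vspan0 => {}x /(face_sub ftht); rewrite tE => -[].
have thI x : x \in vspan s -> ev l x = 0 -> ev q x = 0 -> x \in vspan th.
  move=> xs lx qx.
  have xU : x \in (vspan s :&: hyper l)%VS by rewrite memv_cap xs; apply/hyperP.
  have dU : \dim (vspan s :&: hyper l)%VS = (cdim th).+1.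
    apply/eqP; rewrite -eqSS -ds; apply/eqP; symmetry.
    apply: (@dim_cap_hyper_lt _ _ _ _ z1); first by apply: mem_vspan; case: z1t.
    by apply/eqP; rewrite gt_eqF.
  apply: (@eq_hyper_cap _ _ (vspan s :&: hyper l)%VS (vspan th) q y) => //.
    rewrite subv_cap (face_span fth); apply: vspan_sub => w; rewrite thE => -[_ ?].
    exact/hyperP.
  by rewrite memv_cap ys; apply/hyperP.
have cfg1 x : ev f1 x = 0 -> ev f2 x = (c1 + c2) * ev l x.
  by move=> h; rewrite -f12 h add0r.
have cfg2 x : ev f2 x = 0 -> ev f1 x = (c1 + c2) * ev l x.
  by move=> h; rewrite -f12 h addr0.
have [sz1 f1z1] := z1t; have [sz2 f2z2] := z2t.
have f2z1 : 0 < ev f2 z1 by rewrite cfg1 // mulr_gt0.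
have f1z2 : 0 < ev f1 z2 by rewrite cfg2 // mulr_gt0.
have gE x : x \in vspan s ->
    ev g x = ev f2 x / ev f2 z1 * ev g z1 + ev f1 x / ev f1 z2 * ev g z2.
  (* Since [f1] kills [z1] and [f2] kills [z2], these coefficients make both forms vanish at [x'];
     then so do [l] and [q], and [x'] lies in the hull of [th]. *)
  move=> xs; pose x' := x - (ev f2 x / ev f2 z1) *: z1 - (ev f1 x / ev f1 z2) *: z2.
  have f1x' : ev f1 x' = 0.
    by rewrite !evBr !evZr f1z1 mulr0 subr0 divfK ?subrr ?gt_eqF.
  have f2x' : ev f2 x' = 0.
    by rewrite !evBr !evZr f2z2 mulr0 subr0 divfK ?subrr ?gt_eqF.
  have lx' : ev l x' = 0.
    have /esym/eqP := f12 x'; rewrite f1x' f2x' addr0 mulf_eq0 gt_eqF //= => /eqP //.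
  have : x' \in vspan th.
    apply: thI => //; first by rewrite !memvB // memvZ // mem_vspan.
    by move: f1x'; rewrite evBl evZl lx'; lra.
  by move=> /gth; rewrite !evBr !evZr; lra.
have [z tz lz] : exists2 z, t z & 0 < ev l z.
  apply: contrapT => no.
  have : t = th.
    apply/seteqP; split; last exact: face_sub.
    move=> x tx; have sx := face_sub fts tx; rewrite thE; split=> //.
    apply/eqP; rewrite eq_le l0 // andbT leNgt; apply/negP => lx.
    by apply: no; exists x.
  by move=> e; move: dt; rewrite e => /n_Sn.
have sz := face_sub fts tz.
have gz : ev g z = 0 by move: tz; rewrite tE => -[].
have f12z : 0 < ev f1 z + ev f2 z by rewrite f12 mulr_gt0.
have := f1s _ sz; have := f2s _ sz => f2z f1z.
have gz1 := g0 _ sz1; have gz2 := g0 _ sz2.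
have tNs : (exists2 x, s x & ev g x != 0).
  apply: contrapT => no.
  have : t = s.
    rewrite tE; apply/seteqP; split=> [x []//|x sx]; split=> //.
    by apply: contrapT => /eqP gx; apply: no; exists x.
  by move=> e; move: dt; rewrite e ds => /esym /n_Sn.
have := gE _ (mem_vspan sz); rewrite gz => /esym/eqP.
rewrite paddr_eq0 ?mulr_ge0 ?invr_ge0 ?(ltW f2z1) ?(ltW f1z2) //.
rewrite !mulf_eq0 !invr_eq0 (gt_eqF f2z1) (gt_eqF f1z2) !orbF => /andP[h1 h2].
have fin (f : 'rV[R]_n) (a : R) : a != 0 ->
    (forall x, x \in vspan s -> ev g x = a * ev f x) -> t = cut s f.
  move=> a0 gf; rewrite tE; apply/seteqP; split=> x [sx /eqP]; rewrite ?gf ?mem_vspan//.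
    by rewrite mulf_eq0 (negPf a0) => /eqP.
  by move=> /eqP fx; split=> //; rewrite gf ?mem_vspan // fx mulr0.
have [gz10|gz10] := eqVneq (ev g z1) 0.
  left; apply: (fin _ (ev g z2 / ev f1 z2)) => [|x /gE ->]; last first.
    by rewrite gz10 mulr0 add0r mulrC mulrA mulrAC.
  rewrite mulf_neq0 ?invr_neq0 ?(gt_eqF f1z2) //.
  case: tNs => x sx; apply: contra => /eqP gz20.
  by rewrite gE ?mem_vspan // gz10 gz20 !mulr0 addr0.
right; apply: (fin _ (ev g z1 / ev f2 z1)) => [|x /gE ->].
  by rewrite mulf_neq0 ?invr_neq0 ?(gt_eqF f2z1).
move: h1; rewrite (negPf gz10) orbF => /eqP f2z0.
move: f12z; rewrite f2z0 addr0 => f1z0.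
move: h2; rewrite (gt_eqF f1z0) /= => /eqP ->.
by rewrite mulr0 addr0 mulrC mulrA mulrAC.
Qed.

Lemma primgen_form_pos s t f : rational_cone s -> cdim s = (cdim t).+1 ->
  (forall x, s x -> 0 <= ev f x) -> t = cut s f -> 0 < ev f (primgen s t).
Proof.
move=> rs ds f0 tE; have fts : face t s by rewrite tE; exact: cut_face.
have [u ut su] := primgen_face rs fts ds.
have fu : ev f u = 0 by apply: ev_vspan0 ut => x; rewrite tE => -[].
have fv : 0 <= ev f (primgen s t) by have := f0 _ su; rewrite evDr fu addr0.
rewrite lt_neqAle fv andbT; apply/negP => /eqP e.
have /negP := primgen_notin rs fts ds; apply.
have tm x : s x -> ev f x = 0 -> t x by rewrite tE.
rewrite -[primgen s t](addrK u) memvB // mem_vspan //; apply: tm su _.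
by rewrite evDr -e fu addr0.
Qed.

(** The 2-form given by the exterior product of [p] and [q]; when both vanish on the hull of [th],
    it is an oriented area modulo that hull. *)
Definition wedge (p q v w : 'rV[R]_n) : R := ev p v * ev q w - ev q v * ev p w.

(** The two primitive generators form a basis of the lattice of [s] modulo that of [th]; [M] is the
    determinant of the coordinates of [v] and [w]. *)
Lemma wedge_chain s t th v w : rational_cone s -> rational_cone t ->
  face t s -> face th t -> cdim s = (cdim t).+1 -> cdim t = (cdim th).+1 ->
  lattice_of s v -> lattice_of s w ->
  exists M : int, forall p q : 'rV[R]_n,
    {in vspan th, forall x, ev p x = 0} -> {in vspan th, forall x, ev q x = 0} ->
    wedge p q v w = M%:~R * wedge p q (primgen s t) (primgen t th).
Proof.
move=> rs rt fts ftht ds dt hv hw.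
have dec x : lattice_of s x -> exists a b : int,
    x - a%:~R *: primgen s t - b%:~R *: primgen t th \in vspan th.
  have [_ _ gs] := primgenP rs fts ds; have [_ _ gt] := primgenP rt ftht dt.
  by move=> /gs[a /gt[b [h _]]]; exists a, b.
have [a [b hab]] := dec v hv; have [c [d hcd]] := dec w hw.
exists (a * d - b * c) => p q hp hq; rewrite /wedge rmorphB !rmorphM /=.
have h1 := hp _ hab; have h2 := hp _ hcd; have h3 := hq _ hab; have h4 := hq _ hcd.
move: h1 h2 h3 h4; rewrite !evBr !evZr => h1 h2 h3 h4.
have -> : ev p v = a%:~R * ev p (primgen s t) + b%:~R * ev p (primgen t th) by lra.
have -> : ev p w = c%:~R * ev p (primgen s t) + d%:~R * ev p (primgen t th) by lra.
have -> : ev q v = a%:~R * ev q (primgen s t) + b%:~R * ev q (primgen t th) by lra.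
have -> : ev q w = c%:~R * ev q (primgen s t) + d%:~R * ev q (primgen t th) by lra.
ring.
Qed.

(* The pairs (v_{s/t}, v_{t/th}) given by the two facets are bases of the same rank
   two lattice Z_s / Z_th, with opposite orientations. *)
Lemma wedge_facets s t1 t2 th p q : rational_cone s -> face th s -> cdim s = (cdim th).+2 ->
  rational_cone t1 -> rational_cone t2 ->
  between th s t1 -> between th s t2 -> t1 <> t2 ->
  {in vspan th, forall x, ev p x = 0} -> {in vspan th, forall x, ev q x = 0} ->
  wedge p q (primgen s t1) (primgen t1 th) + wedge p q (primgen s t2) (primgen t2 th) = 0.
Proof.
move=> rs fth ds rt1 rt2 bt1 bt2 t12 hp hq.
have [l [f1 [f2 [c [[l0 f10 f20] [thE fE] _ _ [_ only]]]]]] := two_facets rs fth ds.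
wlog [e1 e2] : t1 t2 rt1 rt2 bt1 bt2 t12 / t1 = cut s f1 /\ t2 = cut s f2.
  move=> wl; have [e1|e1] := only _ bt1; have [e2|e2] := only _ bt2.
  - by case: t12; rewrite e1.
  - exact: wl.
  - by rewrite addrC; apply: wl => //; apply: nesym.
  - by case: t12; rewrite e1.
case: bt1 bt2 => d1 fth1 ft1 [d2 fth2 ft2].
have ds1 : cdim s = (cdim t1).+1 by rewrite d1.
have ds2 : cdim s = (cdim t2).+1 by rewrite d2.
have latt t : rational_cone t -> face th t -> face t s -> cdim s = (cdim t).+1 ->
    cdim t = (cdim th).+1 -> lattice_of s (primgen s t) /\ lattice_of s (primgen t th).
  move=> rt ftht fts dst dt; have [h1 _ _] := primgenP rs fts dst; split=> //.
  by have [[h2 h3] _ _] := primgenP rt ftht dt; split=> //; apply: subvP h2; apply: face_span.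
have [lv1 lw1] := latt _ rt1 fth1 ft1 ds1 d1.
have [lv2 lw2] := latt _ rt2 fth2 ft2 ds2 d2.
have [M hM] := wedge_chain rs rt1 ft1 fth1 ds1 d1 lv2 lw2.
have [N hN] := wedge_chain rs rt2 ft2 fth2 ds2 d2 lv1 lw1.
have lth : {in vspan th, forall x, ev l x = 0}.
  by apply: ev_vspan0 => x; rewrite thE => -[].
have f1th : {in vspan th, forall x, ev f1 x = 0}.
  by apply: ev_vspan0 => x /(face_sub fth1); rewrite e1 => -[].
have lpos t : rational_cone t -> face th t -> face t s -> cdim t = (cdim th).+1 ->
    0 < ev l (primgen t th).
  move=> rt ftht fts dt; apply: primgen_form_pos => //; first by move=> x /(face_sub fts) /l0.
  apply/seteqP; split=> x.
    by move=> thx; split; [exact: (face_sub ftht)|move: thx; rewrite thE => -[]].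
  by move=> [/(face_sub fts) sx lx]; rewrite thE.
have l1 := lpos _ rt1 fth1 ft1 d1; have l2 := lpos _ rt2 fth2 ft2 d2.
have p1 := primgen_form_pos rs ds1 f10 e1; have p2 := primgen_form_pos rs ds2 f20 e2.
have mem t f : rational_cone t -> face th t -> cdim t = (cdim th).+1 ->
   t = cut s f -> ev f (primgen t th) = 0.
  move=> rt ftht dt tE; apply: ev_vspan0 (primgen_span rt ftht dt).
  by move=> x; rewrite tE => -[].
have m1 := mem _ _ rt1 fth1 d1 e1; have m2 := mem _ _ rt2 fth2 d2 e2.
have fEx x : ev f1 x = c * ev l x - ev f2 x by rewrite -evZl -fE evDl addrK.
(* The pair [l], [f1] detects the orientation: the opposite signs make [M] negative, and [N * M = 1]
   then leaves only [M = -1]. *)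
have W1 : wedge l f1 (primgen s t1) (primgen t1 th) < 0.
  by rewrite /wedge m1 mulr0 sub0r oppr_lt0 mulr_gt0.
have W2 : 0 < wedge l f1 (primgen s t2) (primgen t2 th).
  by rewrite /wedge !fEx m2; have := mulr_gt0 p2 l2; lra.
have := hM _ _ lth f1th; have := hN _ _ lth f1th.
set w1 := wedge _ _ _ _ in W1 *; set w2 := wedge _ _ _ _ in W2 * => hw1 hw2.
have M0 : M < 0 by rewrite -(ltr_int R); move: W2; rewrite hw2 nmulr_lgt0.
have MN : N * M = 1.
  apply/eqP; rewrite -(eqr_int R) rmorphM /=; apply/eqP.
  have w10 : w1 != 0 by rewrite lt_eqF.
  by apply: (mulIf w10); rewrite mul1r -mulrA -hw2 -hw1.
have M1 : M = -1 by have := congr1 absz MN; rewrite abszM; lia.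
by rewrite (hM _ _ hp hq) M1 mulN1r addrN.
Qed.
End Diamond.
(** * Balanced fans in half-spaces *)

Lemma count_lt (T : eqType) (r : seq T) (a b : pred T) x :
  subpred a b -> x \in r -> b x -> ~~ a x -> (count a r < count b r)%N.
Proof.
move=> ab xr bx ax; rewrite !(permP (perm_to_rem xr)) /= bx (negPf ax) add1n ltnS.
exact: sub_count.
Qed.

Section HalfSpace.
Variables (R : realType) (n : nat).
Variables (F : wfan R n) (r : seq (set 'rV[R]_n)).
Hypotheses (rF : rational_fan F) (Fr : forall s, s \in r <-> cones F s).
Implicit Types (s t th : set 'rV[R]_n) (m x v : 'rV[R]_n).

Lemma fan_rational s : cones F s -> rational_cone s.
Proof. by case: rF => _ + _ _; apply. Qed.

Lemma fan_face s t : cones F s -> face t s -> cones F t.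
Proof. by case: rF => _ _ + _; apply. Qed.

Lemma fan_sub_face s t : cones F s -> cones F t -> t `<=` s -> face t s.
Proof.
case: rF => _ _ _ h sF tF ts; have [+ _] := h _ _ sF tF.
by rewrite setIC (setIidl ts).
Qed.

Variables (k : nat) (w : set 'rV[R]_n -> R) (K : {vspace 'rV[R]_n}).
Implicit Types (C D : pred (set 'rV[R]_n)).

Definition transverse_cones C : Prop := forall s, C s ->
  [/\ cones F s, cdim s = k, 0 < w s & forall x, x \in vspan s -> x \in K -> x = 0].

(* Testing against the forms that vanish on [K] and on the span of [t] amounts to
   balancing the images of the cones modulo [K]. *)
Definition balanced_around C (rh : set 'rV[R]_n) : Prop :=
  forall t m, cones F t -> (cdim t).+1 = k -> rh `<=` t ->
    {in vspan t, forall x, ev m x = 0} -> {in K, forall x, ev m x = 0} ->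
    \sum_(s <- r | C s && `[< face t s >]) w s * ev m (primgen s t) = 0.

Definition vanish m (s : set 'rV[R]_n) : Prop := forall x, s x -> ev m x = 0.

Definition nonvanishing C m : pred (set 'rV[R]_n) := fun s => C s && ~~ `[< vanish m s >].

(* Among the cones on which [m] does not vanish, [m < 0] away from [rh]; adding to
   [m] a form [h] tilts the hyperplane until it first touches a cone along a face
   larger than [rh], so that this cone can be discarded by induction. *)
Lemma half_space C rh m : cones F rh -> transverse_cones C ->
  (forall s, C s -> rh `<=` s) -> balanced_around C rh ->
  {in K, forall x, ev m x = 0} -> vanish m rh ->
  (forall s x, C s -> s x -> ev m x <= 0) -> forall s, C s -> vanish m s.
Proof.
(* Each recursive call either enlarges [rh] without adding cones or keeps [rh] and discards a
   cone. *)
have [N] := ubnP ((k - cdim rh) + count C r).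
elim: N C rh m => // N IH C rh m hN rhF tC Crh bC mK mrh mC s0 Cs0.
have [s0F ds0 ws0 gs0] := tC _ Cs0.
have rhs0 := fan_sub_face s0F rhF (Crh _ Cs0).
have drh : (cdim rh <= k)%N by rewrite -ds0 cdimS //; exact: Crh.
case: (ltngtP (cdim rh) k) drh => // [drh _|drh _]; last first.
  by rewrite -(face_eq rhs0) // ds0 drh.
have step D m1 t : subpred D C -> balanced_around D rh ->
    {in K, forall x, ev m1 x = 0} -> (forall s x, D s -> s x -> ev m1 x <= 0) ->
    cones F t -> rh `<=` t -> t <> rh -> vanish m1 t ->
    forall s, D s -> t `<=` s -> vanish m1 s.
  move=> DC bD m1K m1D tF rht tNrh m1t s Ds ts.
  have dt : (cdim rh < cdim t)%N.
    rewrite ltnNge; apply/negP => d.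
    by apply: tNrh; rewrite (face_eq (fan_sub_face tF rhF rht) d).
  have [sF ds _ _] := tC _ (DC _ Ds).
  have dtk : (cdim t <= k)%N by rewrite -ds cdimS.
  pose D' := fun s => D s && `[< t `<=` s >].
  apply: (IH D' t m1) => //.
  - have cD : (count D' r <= count C r)%N by apply: sub_count => u /andP[/DC].
    by move: hN cD drh dt dtk; lia.
  - by move=> u /andP[/DC /tC].
  - by move=> u /andP[_ /asboolP].
  - move=> t' m' t'F dt' tt' m't' m'K.
    rewrite -[RHS](bD t' m' t'F dt' _ m't' m'K); last exact: subset_trans tt'.
    apply: eq_bigl => u; rewrite /D' -andbA; congr (_ && _).
    apply/andP/idP => [[]//|h]; split=> //; apply/asboolP.
    by apply: subset_trans tt' _; apply: face_sub; exact/asboolP.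
  - by move=> u x /andP[/m1D h _]; apply: h.
  - by rewrite /D' Ds; exact/asboolP.
(* When [rh] has codimension one, balancing around it is a vanishing sum of terms of one sign, so
   [m] kills [primgen s0 rh] and hence [s0]. *)
case: (ltngtP (cdim rh).+1 k) (drh) => // [drh2 _|drh1 _]; last first.
  have := bC rh m rhF drh1 (@subset_refl _ _) (ev_vspan0 mrh) mK.
  have mv s : C s -> ev m (primgen s rh) <= 0.
    move=> Cs; have [sF ds _ _] := tC _ Cs.
    have fs := fan_sub_face sF rhF (Crh _ Cs).
    have [|u urh su] := primgen_face (fan_rational sF) fs; first by rewrite ds.
    by have := mC _ _ Cs su; rewrite evDr (ev_vspan0 mrh urh) addr0.
  move=> /eqP; rewrite -oppr_eq0 -sumrN psumr_eq0; last first.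
    move=> s /andP[Cs _]; have [_ _ ws _] := tC _ Cs.
    by rewrite oppr_ge0 mulr_ge0_le0 ?mv ?ltW.
  move=> /allP /(_ s0); rewrite Cs0 oppr_eq0 mulf_eq0 (gt_eqF ws0) /=.
  move=> /(_ (proj2 (Fr s0) s0F)) /implyP; rewrite asboolT // => /(_ isT) /eqP mv0.
  move=> x sx.
  have [|c xc] := primgen_decomp (fan_rational s0F) rhs0 _ (mem_vspan sx); first by rewrite ds0.
  by have := ev_vspan0 mrh xc; rewrite evBr evZr mv0 mulr0 subr0.
(* By [step], a form vanishing on [t] vanishes on all cones of [D] around [t]. Discarding the cones
   on which it vanishes therefore removes the star of [t] entirely or leaves it intact. *)
have restrict D m1 : subpred D C -> balanced_around D rh ->
    {in K, forall x, ev m1 x = 0} -> (forall s x, D s -> s x -> ev m1 x <= 0) ->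
    balanced_around (nonvanishing D m1) rh.
  move=> DC bD m1K m1D t m' tF dt rht m't m'K.
  have tNrh : t <> rh by move=> e; move: drh2; rewrite -dt e ltnn.
  have [m1t|m1t] := pselect (vanish m1 t).
    rewrite big_pred0 // => s; apply/negP => /andP[/andP[Ds /asboolP h] /asboolP fts].
    by apply: h; apply: (step D m1 t) => //; exact: face_sub.
  rewrite -[RHS](bD t m' tF dt rht m't m'K); apply: eq_bigl => s.
  rewrite /nonvanishing -andbA; congr (_ && _).
  apply/andP/idP => [[]//|h]; split=> //; apply/asboolP => m1s.
  by apply: m1t => x tx; apply: m1s; apply: face_sub tx; exact/asboolP.
apply: contrapT => ms0.
pose C0 := nonvanishing C m.
have C0C : subpred C0 C by move=> s /andP[].
have bC0 : balanced_around C0 rh by exact: restrict.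
have C0s0 : C0 s0 by rewrite /C0 /nonvanishing Cs0; exact/asboolP.
(* A larger contact face with [m = 0] would, by [step], make [m] vanish on the whole cone. *)
have m0rh s x : C0 s -> s x -> ev m x = 0 -> rh x.
  move=> C0s sx mx; have Cs := C0C _ C0s; have [sF _ _ _] := tC _ Cs.
  have ft : face (cut s (- m)) s.
    by apply: cut_face => y sy; rewrite evNl oppr_ge0 (mC _ _ Cs).
  have rht : rh `<=` cut s (- m).
    by move=> y rhy; split; [exact: (Crh _ Cs)|rewrite evNl mrh ?oppr0].
  have xt : cut s (- m) x by split=> //; rewrite evNl mx oppr0.
  have [e|tNrh] := pselect (cut s (- m) = rh); first by rewrite -e.
  case/andP: C0s => _ /asboolP; case.
  apply: (step C m (cut s (- m))) => //.
  - exact: fan_face ft.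
  - by move=> y [_]; rewrite evNl => /eqP; rewrite oppr_eq0 => /eqP.
  - exact: face_sub.
(* Here [rh] has codimension at least two in [s0], so the kernel of [m] on the hull of [s0] is too
   large to lie in the hull of [rh]. *)
have [z [zs mz zrh]] : exists z, [/\ z \in vspan s0, ev m z = 0 & z \notin vspan rh].
  apply: contrapT => no.
  have : (vspan s0 :&: hyper m <= vspan rh)%VS.
    apply/subvP => y; rewrite memv_cap => /andP[ys /hyperP my].
    by apply: contrapT => /negP yrh; apply: no; exists y.
  move=> /dimvS; rewrite leqNgt => /negP; apply.
  rewrite -/(cdim rh); have := dim_cap_hyper (vspan s0) m; rewrite -/(cdim s0) ds0.
  by move: drh2; lia.
(* Transversality of [s0] to [K] lets [h] vanish on [rh] and [K] with value 1 at [z]. As [m] is 0 at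
   [z], no form [h + c *: m] vanishes on [s0]. *)
have zU : z \notin (vspan rh + K)%VS.
  apply: contra zrh => /memv_addP[y yrh [u uK zE]].
  suff u0 : u = 0 by rewrite zE u0 addr0.
  apply: gs0 uK; rewrite -[u](addKr y) -zE addrC memvB //.
  by apply: subvP yrh; apply: face_span.
have [h [hU hz]] := separating_form zU.
have hK : {in K, forall x, ev h x = 0} by move=> x xK; apply/hU/(subvP (addvSr _ _)).
have hrh : vanish h rh.
  by move=> x /mem_vspan xrh; apply/hU/(subvP (addvSl _ _)).
have [X gX] : exists X : set 'rV[R]_n -> seq 'rV[R]_n, forall s, cones F s -> generates (X s) s.
  have gex s : exists X, cones F s -> generates X s.
    have [sF|] := pselect (cones F s); last by exists [::].
    by have [X] := rational_generates (fan_rational sF); exists X.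
  by exists (fun s => xget [::] [set X | cones F s -> generates X s]) => s;
     have [X hX] := gex s; apply: (@xgetPex _ [::] [set X | cones F s -> generates X s]); exists X.
have mle s x : C0 s -> x \in X s -> ev m x <= 0.
  move=> /C0C Cs xX; have [sF _ _ _] := tC _ Cs.
  by apply: (mC _ _ Cs); have [Xs _] := gX _ sF; exact: Xs.
pose XX := flatten [seq X s | s <- r & C0 s].
have XXP x : reflect (exists2 s, C0 s & x \in X s) (x \in XX).
  apply: (iffP flatten_mapP) => [[s]|[s C0s xX]].
    by rewrite mem_filter => /andP[C0s _]; exists s.
  exists s => //; rewrite mem_filter C0s; apply/Fr.
  by have [] := tC _ (C0C _ C0s).
have hasXX : has (fun x => ev m x < 0) XX.
  apply: contrapT => /negP /hasPn no; apply: ms0 => x sx.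
  have [_ gX0] := gX _ s0F.
  apply/eqP; rewrite eq_le (mC _ _ Cs0 sx) /=; apply: gX0 sx => y yX.
  have := no y; rewrite -leNgt; apply; apply/XXP; by exists s0.
have [x1 [/XXP[s1 C0s1 x1X] mx1 max1]] := seq_argmax (fun x => ev h x / - ev m x) hasXX.
(* The maximality of this ratio makes [m'] nonpositive on all cones of [C0], with equality at [x1],
   which is not in [rh]. *)
pose c := ev h x1 / - ev m x1; pose m' := h + c *: m.
have m'K : {in K, forall x, ev m' x = 0}.
  by move=> x xK; rewrite evDl evZl hK // mK // mulr0 addr0.
have m'rh : vanish m' rh.
  by move=> x xrh; rewrite evDl evZl hrh // mrh // mulr0 addr0.
have m'C0 s x : C0 s -> s x -> ev m' x <= 0.
  move=> C0s sx; have [sF _ _ _] := tC _ (C0C _ C0s); have [Xs gXs] := gX _ sF.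
  rewrite -oppr_ge0 -evNl; apply: gXs sx => y yX; rewrite evNl oppr_ge0 evDl evZl.
  have := mle _ _ C0s yX; rewrite le_eqVlt => /orP[/eqP my|my].
    by rewrite my mulr0 addr0 hrh //; apply: (m0rh s) => //; exact: Xs.
  have /max1 /(_ my) : y \in XX by apply/XXP; exists s.
  by rewrite /= ler_pdivrMr ?oppr_gt0 // -/c mulrN; lra.
have m'x1 : ev m' x1 = 0.
  by rewrite evDl evZl /c invrN mulrN mulNr divfK ?lt_eqF// subrr.
pose C1 := nonvanishing C0 m'.
have C1C : subpred C1 C by move=> s /andP[/C0C].
have C1s0 : C1 s0.
  rewrite /C1 /nonvanishing C0s0; apply/asboolP => /ev_vspan0 /(_ _ zs).
  by rewrite evDl evZl mz mulr0 addr0 hz => /eqP; rewrite oner_eq0.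
have [s1F _ _ _] := tC _ (C0C _ C0s1).
have s1x1 : s1 x1 by have [Xs _] := gX _ s1F; exact: Xs.
have C1s1 : ~~ C1 s1.
  rewrite /C1 /nonvanishing C0s1 negbK; apply/asboolP.
  have ft : face (cut s1 (- m')) s1.
    by apply: cut_face => y sy; rewrite evNl oppr_ge0 (m'C0 _ _ C0s1).
  apply: (step C0 m' (cut s1 (- m'))) => //.
  - exact: fan_face ft.
  - move=> y rhy; split; first exact: (Crh _ (C0C _ C0s1)).
    by rewrite evNl m'rh ?oppr0.
  - move=> e; have : cut s1 (- m') x1 by split=> //; rewrite evNl m'x1 oppr0.
    by rewrite e => /mrh mx10; move: mx1; rewrite mx10 ltxx.
  - by move=> y [_]; rewrite evNl => /eqP; rewrite oppr_eq0 => /eqP.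
  - exact: face_sub.
(* The touched cone [s1] has been discarded and [s0] kept, so induction applies to the original
   [m]. *)
apply: ms0; apply: (IH C1 rh m) => //.
- have : (count C1 r < count C r)%N.
    by apply: (@count_lt _ _ _ _ s1) => //; [apply/Fr|exact: C0C].
  by move: hN; lia.
- by move=> s /C1C /tC.
- by move=> s /C1C /Crh.
- by apply: restrict => // s x /C0C.
- by move=> s x /C1C; exact: mC.
Qed.

End HalfSpace.
(** * Products with tropical functions *)

Lemma fsbig_seq_cond (I : choiceType) (V : zmodType) (r : seq I) (A : set I)
    (f : I -> V) : uniq r -> A `<=` [set` r] ->
  \sum_(i \in A) f i = \sum_(i <- r | `[< A i >]) f i.
Proof.
move=> ur Ar; rewrite (bigfs _ ur) => [|i /asboolP Ai]; last by rewrite (Ar _ Ai).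
have -> // : [set` fun i => `[< A i >]] = A by apply/seteqP; split=> i /asboolP.
Qed.

Section Products.
Variables (R : realType) (n : nat) (T : tropical_regular n).
Implicit Types (F : wfan R n) (s t th : set 'rV[R]_n) (l x v : 'rV[R]_n).

Definition tform (i : 'I_(tr_size T).+1) : 'rV[R]_n := intvec R (tr_form T i).

Lemma tform_le i x : ev (tform i) x <= teval T x.
Proof. by rewrite /teval; apply: (le_bigmax _ (fun i => ev (tform i) x)). Qed.

Lemma teval_attained x : exists i, teval T x = ev (tform i) x.
Proof.
rewrite /teval; elim/big_ind: _ => [|a b [i ->] [j ->]|i _].
- by exists ord0.
- by rewrite maxEle; case: ifP => _; [exists j|exists i].
- by exists i.
Qed.

Lemma tform_zero : exists i, tform i = 0.
Proof.
have [i i0] := tr_zero T; exists i; rewrite /tform i0.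
by apply/rowP => j; rewrite !mxE.
Qed.

Lemma linealityP x : lineality R T x <-> forall i, ev (tform i) x = 0.
Proof.
split=> [h i|h i j]; last by have := h i; have := h j; rewrite /tform => -> ->.
by have [j j0] := tform_zero; have := h i j; rewrite -!/(tform _) j0 ev0l.
Qed.

Definition active s i : Prop := linear_form_on T s (tform i).

(** Take [l_i] attaining [T] at a relative interior point. The nonnegative form [l - l_i] vanishes
    there, and stepping on in the direction [- x] shows that it vanishes at [x]. *)
Lemma activeP s l : rational_cone s -> linear_form_on T s l -> exists i, active s i.
Proof.
move=> rs sl; have [y sy hy] := rational_relint rs.
have [i yi] := teval_attained y; exists i => x sx.
apply/eqP; rewrite eq_le tform_le andbT.
have [|e e0 se] := hy (- x); first by rewrite memvN mem_vspan.
have := tform_le i (y + e *: - x); rewrite (sl _ se) (sl _ sx).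
have ly : ev l y = ev (tform i) y by rewrite -(sl _ sy).
rewrite !evDr !evZr !evNr ly lerD2l ler_pM2l // lerN2; exact.
Qed.

Lemma linear_form_eq s l l' : linear_form_on T s l -> linear_form_on T s l' ->
  {in vspan s, forall x, ev l x = ev l' x}.
Proof. by move=> h h'; apply: ev_vspan_eq => x sx; rewrite -h // -h'. Qed.

Lemma linear_form_sub s t l : t `<=` s -> linear_form_on T s l -> linear_form_on T t l.
Proof. by move=> ts h x /ts /h. Qed.

Lemma linextP F s : linear_on_cones T F -> cones F s -> linear_form_on T s (linext T s).
Proof. by move=> h /h [l hl]; apply: (@xgetPex _ 0 (linear_form_on T s)); exists l. Qed.

Lemma fan_seq F : rational_fan F -> exists2 r, uniq r & forall s, s \in r <-> cones F s.
Proof.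
case=> /finite_seqP[r rE] _ _ _; exists (undup r); first exact: undup_uniq.
by move=> s; rewrite mem_undup rE.
Qed.

Section Star.
Variables (F : wfan R n) (r : seq (set 'rV[R]_n)) (k : nat).
Hypotheses (rF : rational_fan F) (ur : uniq r) (Fr : forall s, s \in r <-> cones F s).
Hypotheses (bF : balanced F k.+1) (lF : linear_on_cones T F).

Lemma star_sum (V : zmodType) j t (f : set 'rV[R]_n -> V) :
  \sum_(s \in star_max F j t) f s = \sum_(s <- r | `[< star_max F j t s >]) f s.
Proof. by apply: fsbig_seq_cond => // s [[sF _] _]; apply/Fr. Qed.

Lemma star_balanced t : cones F t -> cdim t = k ->
  \sum_(s <- r | `[< star_max F k.+1 t s >]) wt F s *: primgen s t \in vspan t.
Proof. by move=> tF dt; rewrite -star_sum; apply: bF => //; rewrite dt. Qed.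

(** Subtracting [linext T th] makes all forms vanish on the hull of [th]. The balancing vector of
    [t] is there a multiple of [primgen t th], which lets the correction term supply the second half
    of each determinant. *)
Lemma prod_wt_wedge th t q : cones F th -> cones F t -> cdim t = k ->
    face th t -> cdim t = (cdim th).+1 -> {in vspan th, forall x, ev q x = 0} ->
  prod_wt T k.+1 F t * ev q (primgen t th) =
  \sum_(s <- r | `[< star_max F k.+1 t s >])
     wt F s * wedge (linext T s - linext T th) q (primgen s t) (primgen t th).
Proof.
move=> thF tF dt ftht dth qth.
pose l := linext T th; pose p s := linext T s - l.
have pth s : th `<=` s -> cones F s -> {in vspan th, forall x, ev (p s) x = 0}.
  move=> ths sF x xth; rewrite evBl.
  rewrite (linear_form_eq (linear_form_sub ths (linextP lF sF)) (linextP lF thF)) //.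
  by rewrite subrr.
set B := \sum_(s <- r | `[< star_max F k.+1 t s >]) wt F s *: primgen s t.
have Bt : B \in vspan t by exact: star_balanced.
have wE : prod_wt T k.+1 F t =
    \sum_(s <- r | `[< star_max F k.+1 t s >]) wt F s * ev (p s) (primgen s t)
      - ev (p t) B.
  rewrite /prod_wt !star_sum -/B evBl opprB addrA; congr (_ - _).
  rewrite ev_sumr -big_split /=; apply: eq_bigr => s _.
  by rewrite !evZr evBl; ring.
have [c Bc] := primgen_decomp (fan_rational rF tF) ftht dth Bt.
have qB : ev q B = c * ev q (primgen t th).
  by apply/eqP; rewrite -subr_eq0 -evZr -evBr qth.
have pB : ev (p t) B = c * ev (p t) (primgen t th).
  by apply/eqP; rewrite -subr_eq0 -evZr -evBr (pth t) //; exact: face_sub.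
have -> : prod_wt T k.+1 F t * ev q (primgen t th) =
    \sum_(s <- r | `[< star_max F k.+1 t s >]) wt F s * ev (p s) (primgen s t) *
      ev q (primgen t th) - ev q B * ev (p t) (primgen t th).
  by rewrite wE mulrBl mulr_suml pB qB; congr (_ - _); ring.
rewrite ev_sumr mulr_suml -sumrB; apply: eq_bigr => s /asboolP[[sF _] fts].
rewrite evZr /wedge -/l -/(p s).
suff -> : ev (p t) (primgen t th) = ev (p s) (primgen t th) by ring.
rewrite !evBl; congr (_ - _).
apply: (linear_form_eq (linextP lF tF) (linear_form_sub (face_sub fts) (linextP lF sF))).
exact: primgen_span (fan_rational rF tF) ftht dth.
Qed.

(** Test against a form [q] that kills the hull of [th] and exchange the sums: each maximal cone [s]
    around [th] contributes the determinants of its two facets containing [th], which cancel by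
    [wedge_facets]. *)
Lemma balanced_tprod : balanced (tprod T k F) k.
Proof.
move=> th [thF _] dk; apply: contrapT => /negP /separating_form[q [qth qX]].
suff : ev q (\sum_(t \in star_max (tprod T k F) k th)
               wt (tprod T k F) t *: primgen t th) = 0.
  by rewrite qX => /eqP; rewrite oner_eq0.
rewrite (@fsbig_seq_cond _ _ r) //; last by move=> s [[[sF _] _] _]; apply/Fr.
rewrite ev_sumr.
pose f s t := wedge (linext T s - linext T th) q (primgen s t) (primgen t th).
transitivity (\sum_(t <- r | `[< star_max (tprod T k F) k th t >])
   \sum_(s <- r | `[< star_max F k.+1 t s >]) wt F s * f s t).
  apply: eq_bigr => t /asboolP[[[tF _] dt] ftht].
  by rewrite evZr; apply: prod_wt_wedge => //; rewrite dt.
rewrite (exchange_big_dep xpredT) //= big_seq big1 // => s /Fr sF.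
rewrite -mulr_sumr; apply/eqP; rewrite mulf_eq0; apply/orP; right; apply/eqP.
pose bt t := `[< cones F t /\ between th s t >].
have [ds|ds] := eqVneq (cdim s) k.+1; last first.
  rewrite big_pred0 // => t; apply/negP => /andP[_ /asboolP[[_ e] _]].
  by rewrite e eqxx in ds.
rewrite (eq_bigl bt) => [|t]; last first.
  apply/andP/asboolP.
    by move=> [/asboolP[[[tF _] dt] ftht] /asboolP[_ fts]]; split=> //; split=> //; rewrite dk.
  move=> [tF [dt ftht fts]]; have dt' : cdim t = k by rewrite dt.
  by split; apply/asboolP; split=> //; split=> //; split=> //; rewrite dt'.
have [fth|nfth] := pselect (face th s); last first.
  rewrite big_pred0 // => t; apply/negP => /asboolP[tF [_ ftht fts]]; apply: nfth.
  by apply: (fan_sub_face rF sF thF); apply: subset_trans (face_sub ftht) (face_sub fts).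
have ds2 : cdim s = (cdim th).+2 by rewrite ds -dk.
have rs := fan_rational rF sF.
have pth : {in vspan th, forall x, ev (linext T s - linext T th) x = 0}.
  move=> x xth; rewrite evBl.
  rewrite (linear_form_eq (linear_form_sub (face_sub fth) (linextP lF sF)) (linextP lF thF)) //.
  by rewrite subrr.
have [l [f1 [f2 [c [_ _ b1 b2 [n12 only]]]]]] := two_facets rs fth ds2.
set t1 := cut s f1 in b1 n12 only; set t2 := cut s f2 in b2 n12 only.
have t1F : cones F t1 by case: b1 => _ _; apply: (fan_face rF).
have t2F : cones F t2 by case: b2 => _ _; apply: (fan_face rF).
have b1' : bt t1 by exact/asboolP.
have b2' : bt t2 by exact/asboolP.
have E : perm_eq [seq t <- r | bt t] [:: t1; t2].
  apply: uniq_perm; rewrite ?filter_uniq //= ?andbT ?inE; first exact/eqP.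
  move=> t; rewrite mem_filter !inE; apply/andP/orP => [[/asboolP[_ /only]]|].
    by move=> [->|->] _; rewrite eqxx; [left|right].
  by move=> [/eqP ->|/eqP ->]; split=> //; exact/Fr.
rewrite -big_filter (perm_big _ E) !big_cons big_nil /= addr0.
by apply: wedge_facets => //; apply: (fan_rational rF).
Qed.

(** * Transversality to the lineality space and the weights of the product *)

Hypothesis wF : forall s, cones_dim F k.+1 s -> 0 <= wt F s.

Definition transverse s : Prop := forall x, x \in vspan s -> lineality R T x -> x = 0.

Lemma active_linext s i : cones F s -> active s i ->
  {in vspan s, forall x, ev (linext T s) x = ev (tform i) x}.
Proof. by move=> sF; exact: linear_form_eq (linextP lF sF). Qed.

Lemma star_form0 s t i : star_max F k.+1 t s -> active t i ->
  {in vspan t, forall x, ev (linext T s - tform i) x = 0}.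
Proof.
move=> [[sF _] fts] ti x xt; rewrite evBl.
by rewrite (linear_form_eq (linear_form_sub (face_sub fts) (linextP lF sF)) ti) ?subrr.
Qed.

Lemma star_form_ge0 s t i : cones F t -> cdim t = k -> star_max F k.+1 t s ->
  active t i -> 0 <= ev (linext T s - tform i) (primgen s t).
Proof.
move=> tF dt st ti; have [[sF ds] fts] := st.
have [|u ut su] := primgen_face (fan_rational rF sF) fts; first by rewrite ds dt.
have := tform_le i (primgen s t + u); rewrite (linextP lF sF su) -subr_ge0 -evBl.
by rewrite evDr (star_form0 st ti ut) addr0.
Qed.

Lemma star_active s t i : cones F t -> cdim t = k -> star_max F k.+1 t s ->
  active t i -> ev (linext T s - tform i) (primgen s t) = 0 -> active s i.
Proof.
move=> tF dt st ti h x sx; have [[sF ds] fts] := st.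
rewrite (linextP lF sF sx); apply/eqP; rewrite -subr_eq0 -evBl; apply/eqP.
have [|c xc] := primgen_decomp (fan_rational rF sF) fts _ (mem_vspan sx).
  by rewrite ds dt.
by have := star_form0 st ti xc; rewrite evBr evZr h mulr0 subr0.
Qed.

(** The balancing vector lies in the hull of [t], where [T_t] is [l_i]; so [l_i] can replace [T_t]
    and be distributed over the sum. *)
Lemma prod_wt_active t i : cones F t -> cdim t = k -> active t i ->
  prod_wt T k.+1 F t = \sum_(s <- r | `[< star_max F k.+1 t s >])
     wt F s * ev (linext T s - tform i) (primgen s t).
Proof.
move=> tF dt ti; rewrite /prod_wt !star_sum.
rewrite (active_linext tF ti) ?star_balanced // ev_sumr -sumrB.
by apply: eq_bigr => s _; rewrite !evZr evBl mulrBr.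
Qed.

Lemma fan_active t : cones F t -> exists i, active t i.
Proof. by move=> tF; apply: activeP (fan_rational rF tF) (linextP lF tF). Qed.

Lemma prod_wt_ge0 t : cones F t -> cdim t = k -> 0 <= prod_wt T k.+1 F t.
Proof.
move=> tF dt; have [i ti] := fan_active tF.
rewrite (prod_wt_active tF dt ti) sumr_ge0 // => s /asboolP st.
by rewrite mulr_ge0 ?wF ?star_form_ge0 //; case: st.
Qed.

(* A direction of the lineality space in the span of [s] but not in that of the
   facet [t] is a multiple of [primgen s t] modulo the span of [t]. *)
Lemma lineality_primgen s t m : cones F s -> face t s -> cdim s = (cdim t).+1 ->
  transverse t -> ~ transverse s -> {in vspan t, forall x, ev m x = 0} ->
  (forall x, x \in vspan s -> lineality R T x -> ev m x = 0) -> ev m (primgen s t) = 0.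
Proof.
move=> sF fts ds gt /existsNP[x /not_implyP[xs /not_implyP[xL /eqP x0]]] mt mL.
have [c xc] := primgen_decomp (fan_rational rF sF) fts ds xs.
have := mt _ xc; rewrite evBr evZr mL // sub0r => /eqP.
rewrite oppr_eq0 mulf_eq0 => /orP[/eqP c0|/eqP //].
move: xc x0; rewrite c0 scale0r subr0 => xt.
by rewrite (gt x) ?eqxx.
Qed.

Lemma tprod_not_transverse :
  (forall s, cones_dim F k.+1 s -> wt F s <> 0 -> ~ transverse s) ->
  forall t, cones_dim F k t -> prod_wt T k.+1 F t <> 0 -> ~ transverse t.
Proof.
move=> h t [tF dt] + gt; apply; have [i ti] := fan_active tF.
rewrite (prod_wt_active tF dt ti) big1 // => s /asboolP st.
have [->|/eqP ws] := eqVneq (wt F s) 0; first by rewrite mul0r.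
have [sdim fts] := st; have [sF ds] := sdim; have gs := h s sdim ws.
rewrite lineality_primgen ?mulr0 ?ds ?dt //; first exact: star_form0.
move=> x xs xL; have [j sj] := fan_active sF.
rewrite evBl (active_linext sF sj xs).
by move/linealityP: xL => xL; rewrite !xL subrr.
Qed.

(** The least face of [s] is a linear space, cut out by the sum of its inequalities. As [T] is
    linear there and bounds every [l_i], all [l_i] agree on it; it lies in [L(T)] and is 0 by
    transversality. It serves as the initial [rh] of [half_space]. *)
Lemma zero_cone s : cones F s -> transverse s -> cones F [set 0].
Proof.
move=> sF gs; have [m [a sE]] := fan_rational rF sF.
pose l := \sum_i intvec R (a i).
have lE x : ev l x = \sum_i ev (intvec R (a i)) x.
  by rewrite /l; apply: (big_morph (fun l => ev l x)) => [? ?|]; rewrite ?evDl ?ev0l.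
have fW : face (cut s l) s.
  by apply: cut_face => x; rewrite sE lE => h; rewrite sumr_ge0.
have WF := fan_face rF sF fW.
suff <- : cut s l = [set 0] by [].
have Wa x : cut s l x -> forall i, ev (intvec R (a i)) x = 0.
  move=> [sx]; rewrite lE => /eqP; rewrite psumr_eq0; last first.
    by move=> i _; move: sx; rewrite sE; apply.
  by move=> /allP h i; apply/eqP/h; rewrite mem_index_enum.
have WN x : cut s l x -> cut s l (- x).
  move=> Wx; split; last by rewrite evNr; case: Wx => _ ->; rewrite oppr0.
  by rewrite sE => i; rewrite evNr Wa // oppr0.
apply/seteqP; split=> [x Wx|_ ->]; last first.
  by split; [have [] := rational_convex (fan_rational rF sF)|rewrite ev0r].
have Tp := linextP lF WF.
have pE i : ev (tform i) x = ev (linext T (cut s l)) x.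
  have := tform_le i x; have := tform_le i (- x).
  by rewrite !Tp // ?evNr; [lra|exact: WN].
apply: gs; first by apply: mem_vspan; case: Wx.
apply/linealityP => i; have [j j0] := tform_zero.
by rewrite pE -(pE j) j0 ev0l.
Qed.

Lemma transverse_tprod :
  (forall t, cones_dim F k t -> prod_wt T k.+1 F t <> 0 -> ~ transverse t) ->
  forall s, cones_dim F k.+1 s -> wt F s <> 0 -> ~ transverse s.
Proof.
move=> h s0 [s0F ds0] ws0 gs0; have F0 := zero_cone s0F gs0.
have [i s0i] := fan_active s0F.
pose C : pred (set 'rV[R]_n) := fun s =>
  `[< [/\ cones_dim F k.+1 s, 0 < wt F s, transverse s & active s i] >].
pose K := vspan (lineality R T).
have KP x : x \in K -> lineality R T x.
  move=> xK; apply/linealityP => j; apply: ev_vspan0 xK => y.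
  by move/linealityP.
have Cs0 : C s0.
  by apply/asboolP; split=> //; rewrite lt_neqAle eq_sym wF // andbT; apply/eqP.
have tC : transverse_cones F k.+1 (wt F) K C.
  by move=> s /asboolP[[sF ds] ws gs _]; split=> // x xs /KP; exact: gs.
have C0 s : C s -> [set 0] `<=` s.
  move=> /asboolP[[sF _] _ _ _] _ ->.
  by have [] := rational_convex (fan_rational rF sF).
have bC : balanced_around F r k.+1 (wt F) K C [set 0].
  move=> t m tF [dt] _ mt mK.
  have [[s1 Cs1 fts1]|no] := pselect (exists2 s, C s & face t s); last first.
    rewrite big_pred0 // => s; apply/negP => /andP[Cs /asboolP fts].
    by apply: no; exists s.
  have [[s1F ds1] ws1 gs1 s1i] := asboolP _ Cs1.
  have ti : active t i := linear_form_sub (face_sub fts1) s1i.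
  have gt : transverse t by move=> x xt; apply: gs1; apply: subvP xt; exact: face_span.
  have pt : prod_wt T k.+1 F t = 0 by apply: contrapT => /h; apply.
  (* The zero weight of [t] is a sum of nonnegative terms, so [T = l_i] on every neighbour of
     positive weight. *)
  have act s : star_max F k.+1 t s -> 0 < wt F s -> active s i.
    move=> st ws; have [[sF ds] fts] := st.
    apply: (star_active tF dt st ti); move/eqP: pt.
    rewrite (prod_wt_active tF dt ti) psumr_eq0; last first.
      by move=> u /asboolP su; rewrite mulr_ge0 ?wF ?star_form_ge0 //; case: su.
    move=> /allP /(_ s (proj2 (Fr s) sF)); rewrite asboolT //= mulf_eq0 gt_eqF //=.
    by move/eqP.
  have : ev m (\sum_(s <- r | `[< star_max F k.+1 t s >]) wt F s *: primgen s t) = 0.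
    by apply: mt; apply: star_balanced.
  rewrite ev_sumr => e; rewrite -[RHS]e big_mkcond [RHS]big_mkcond /=.
  apply: eq_big_seq => s /Fr sF.
  (* The sum over [C] and the full balancing sum agree term by term: a cone of the star outside [C]
     has weight 0 or is not transverse, and then [m] kills its generator. *)
  have [st|nst] := pselect (star_max F k.+1 t s); last first.
    rewrite (asboolF nst); case: ifP => // /andP[/asboolP[sd _ _ _] /asboolP fts].
    by case: nst.
  rewrite (asboolT st) evZr; have [sd fts] := st; have [_ ds] := sd.
  rewrite (asboolT fts) andbT; case: ifP => // /asboolP nC.
  have [->|ws] := eqVneq (wt F s) 0; first by rewrite mul0r.
  have ws' : 0 < wt F s by rewrite lt_neqAle eq_sym ws wF.
  rewrite (@lineality_primgen s t) ?mulr0 ?ds ?dt //.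
    by move=> gs; apply: nC; split=> //; exact: act.
  by move=> x _ xL; apply: mK; exact: mem_vspan.
have vj j : vanish (tform j - tform i) s0.
  apply: (half_space rF Fr F0 tC C0 bC _ _ _ Cs0) => //.
  - by move=> x /KP/linealityP xL; rewrite evBl !xL subrr.
  - by move=> x ->; rewrite ev0r.
  - move=> s x /asboolP[_ _ _ si] sx; rewrite evBl subr_le0 -(si _ sx).
    exact: tform_le.
have s0L x : s0 x -> lineality R T x.
  move=> sx; have [j0 j00] := tform_zero.
  have i0 : ev (tform i) x = 0.
    by have := vj j0 x sx; rewrite evBl j00 ev0l sub0r => /eqP; rewrite oppr_eq0 => /eqP.
  by apply/linealityP => j; have := vj j x sx; rewrite evBl i0 subr0.
(* Lying in [L(T)], the transverse cone [s0] is 0, against its positive dimension [k.+1]. *)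
have : (vspan s0 <= 0)%VS.
  apply: vspan_sub => x sx; rewrite memv0; apply/eqP.
  by apply: gs0; [exact: mem_vspan|exact: s0L].
by move=> /dimvS; rewrite dimv0 -/(cdim s0) ds0.
Qed.

End Star.

Lemma rational_fan_tprod F k : rational_fan F -> rational_fan (tprod T k F).
Proof.
move=> [fin rat fac int]; split.
- by apply: sub_finite_set fin => s [].
- by move=> s [/rat].
- move=> s t [sF ds] fts; split; first exact: fac fts.
  by apply: leq_trans ds; apply: cdimS; exact: face_sub.
- by move=> s t [sF _] [tF _]; exact: int.
Qed.

Lemma transverse_degree F k : rational_fan F ->
  (forall s, cones_dim F k s -> 0 <= wt F s) -> balanced F k -> linear_on_cones T F ->
  origin_wt (tpow T k F) = 0 <->
  (forall s, cones_dim F k s -> wt F s <> 0 -> ~ transverse s).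
Proof.
elim: k F => [|k IH] F rF wF bF lF /=.
  (* In dimension 0 the only possible cone is the origin, which is transverse; if it is absent, the
     default weight 0 agrees with the empty condition. *)
  rewrite /origin_wt; split=> [+ s [sF /eqP ds] ws gs|h].
    have s0 : s = [set 0].
      apply/seteqP; split=> [x /mem_vspan|_ ->].
        by move: ds; rewrite dimv_eq0 => /eqP ->; rewrite memv0 => /eqP.
      by have [] := rational_convex (fan_rational rF sF).
    by rewrite asboolT -s0.
  case: asboolP => // F0; apply: contrapT => w0.
  have d0 : (vspan [set (0%R : 'rV[R]_n)] <= 0)%VS.
    by apply: vspan_sub => _ ->; rewrite mem0v.
  apply: (h [set 0]) w0 _; first by split=> //; apply/eqP; move: (dimvS d0); rewrite dimv0 leqn0.
  by move=> x /(subvP d0); rewrite memv0 => /eqP.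
have [r ur Fr] := fan_seq rF.
rewrite IH; first last.
- by move=> s [/lF].
- exact: balanced_tprod ur Fr bF lF.
- by move=> s [[sF _] ds]; apply: prod_wt_ge0 rF ur Fr bF lF wF _ sF ds.
- exact: rational_fan_tprod.
have dE s : cones_dim (tprod T k F) k s <-> cones_dim F k s.
  by split=> [[[]//]|[sF ds]]; split=> //; split=> //; rewrite ds.
split=> h.
  apply: transverse_tprod rF ur Fr bF lF wF _ => t /dE; exact: h.
by move=> t /dE; apply: (tprod_not_transverse rF ur Fr bF lF h).
Qed.

End Products.
(** * Refinements *)

Section Refinements.
Variables (R : realType) (n : nat).
Implicit Types (s t : set 'rV[R]_n) (F G H : wfan R n).

(** Given [y] outside the earlier subspaces but inside [V], and [x] in [s] outside [V], the point
    [x + c *: y] stays outside [V] and, for large [c], outside the others. *)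
Lemma cone_avoids (r : seq {vspace 'rV[R]_n}) s : convex_cone s ->
  (forall V, V \in r -> exists2 x, s x & x \notin V) ->
  exists2 y, s y & forall V, V \in r -> y \notin V.
Proof.
move=> [s0 sD sZ]; elim: r => [|V r IH] h; first by exists 0.
have [W Wr|y sy yr] := IH; first by apply: h; rewrite inE Wr orbT.
have [yV|yV] := boolP (y \in V); last first.
  by exists y => // W; rewrite inE => /orP[/eqP ->|/yr].
have [x sx xV] := h V (mem_head _ _).
have [c c0 cr] : exists2 c : R, 0 <= c &
    forall W d, W \in r -> c <= d -> x + d *: y \notin W.
  elim: r yr {IH h} => [|W r IH] yr; first by exists 0.
  have [U Ur|c c0 cr] := IH; first by apply: yr; rewrite inE Ur orbT.
  have [f [fW fy]] := separating_form (yr W (mem_head _ _)).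
  (* With [f] zero on [W] and 1 at [y], the value of [f] at [x + d *: y] is [ev f x + d], positive
     beyond this bound. *)
  exists (c + `|ev f x| + 1); first by rewrite !addr_ge0.
  move=> U d; rewrite inE => /orP[/eqP ->|Ur] cd; last first.
    by apply: cr => //; apply: le_trans cd; rewrite -addrA lerDl addr_ge0.
  apply/negP => /fW; rewrite evDr evZr fy mulr1.
  by have := ler_norm (- ev f x); rewrite normrN; lra.
exists (x + c *: y); first by apply: sD => //; apply: sZ.
move=> W; rewrite inE => /orP[/eqP ->|Wr]; last exact: cr.
by rewrite rpredDr // memvZ.
Qed.

Lemma cone_cover (r : seq {vspace 'rV[R]_n}) s : convex_cone s ->
  (forall x, s x -> exists2 V, V \in r & x \in V) ->
  exists2 V, V \in r & (vspan s <= V)%VS.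
Proof.
move=> cs cov; apply: contrapT => no.
have [V Vr|y sy yr] := @cone_avoids r s cs.
  apply: contrapT => no'; apply: no; exists V => //; apply: vspan_sub => x sx.
  by apply: contrapT => /negP xV; apply: no'; exists x.
by have [V Vr] := cov y sy; apply/negP; exact: yr.
Qed.

(** The cone [s] is covered by finitely many hulls of cones of [H], so one of them contains it;
    purity bounds its dimension by [k] and gives equality. *)
Lemma refines_span k H F s : tropical_fan F k -> refines k H (trim k F) ->
  cones_dim F k s -> wt F s <> 0 -> exists2 t, cones_dim H k t & vspan t = vspan s.
Proof.
move=> [rF _ _ _] [[rH [dH _] _ _] _ supp _] [sF ds] ws.
have [r _ Hr] := fan_seq rH.
have [|x sx|_ /mapP[t /Hr tH ->] st] := @cone_cover [seq vspan t | t <- r] s.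
- exact: rational_convex (fan_rational rF sF).
- have : Defs.support H x.
    rewrite supp; exists s => //; split=> //; exists s; split=> //; first exact/eqP.
    exact: face_refl.
  by move=> [t tH tx]; exists (vspan t); [apply/map_f/Hr|exact: mem_vspan].
have e : vspan s = vspan t by apply/eqP; rewrite eqEdim st -/(cdim s) ds dH.
by exists t => //; split=> //; rewrite /cdim -e.
Qed.

(** The cone of [trim k F] containing [t] is a face of a maximal cone of nonzero weight and has
    dimension at least [k], so it is that cone. *)
Lemma span_refined k H F t : tropical_fan F k -> refines k H (trim k F) ->
  cones_dim H k t -> exists s, [/\ cones_dim F k s, wt F s <> 0 & vspan s = vspan t].
Proof.
move=> [_ [dF _] _ _] [_ sub _ _] [tH dt].
have [s [sF [s1 [[s1F ds1] ws1 fs]]] ts] := sub _ tH.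
have ds : (k <= cdim s)%N by rewrite -dt cdimS.
have e : s = s1 by apply: face_eq fs _; rewrite ds1.
exists s; split; first by rewrite e.
  by rewrite e; apply/eqP.
by apply/esym/eqP; rewrite eqEdim vspanS // -/(cdim s) e ds1 -dt /=.
Qed.

End Refinements.

(** * Transfer of transversality between representatives *)

Lemma transverseP (R : realType) n (T : tropical_regular n) (s : set 'rV[R]_n) :
  lineality R T `&` [set` vspan s] <> [set 0] <-> ~ transverse T s.
Proof.
split=> h e; apply: h; last first.
  by move=> x xs xL; have : [set 0] x by rewrite -e; split.
apply/seteqP; split=> [x [xL xs]|_ ->]; first exact: e.
by split=> [i j|/=]; rewrite ?ev0r ?mem0v.
Qed.

Theorem theorem3p6 (R : realType) (n k : nat) (F : wfan R n)
    (T : tropical_regular n)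
    (hF : tropical_fan F k)
    (hpos : forall s, cones_dim F k s -> 0 < wt F s)
    (d : R) (hd : deg_pow T k F d) :
  d = 0 <->
  (forall s, cones_dim F k s ->
     lineality R T `&` [set` vspan s] <> [set 0]).
Proof.
have [G [hG [H [HF HG]] lG ->]] := hd.
case: (hG) => rG _ wG bG.
rewrite transverse_degree //; last by move=> s /wG; exact: natr_ge0.
(* The common refinement [H] matches maximal cones of nonzero weight of [F] and [G] with equal
   linear hulls, and transversality depends only on the hull. *)
split=> h s sF.
  apply/transverseP => gs.
  have ws : wt F s <> 0 by apply/eqP; rewrite gt_eqF ?hpos.
  have [t tH ts] := refines_span hF HF sF ws.
  have [g [gG wg gt]] := span_refined hG HG tH.
  by apply: h gG wg _; rewrite /transverse gt ts.
move=> ws gs; have [t tH ts] := refines_span hG HG sF ws.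
have [g [gF _ gt]] := span_refined hF HF tH.
by have /transverseP := h g gF; apply; rewrite /transverse gt ts.
Qed.
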